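(* The Liu–Chen conditions are not necessary for transmissibility over an interference channel. Specifically, for the family of source pairs and interference channels described in the context (with $\eta\ge6$ a fixed even integer), there exist $a^*,k^*\in\mathbb{N}$ such that for all $a\ge a^*$ and $k\ge k^*$, the source pair and IC do not satisfy the Liu–Chen conditions, and yet the source pair is transmissible over the IC.
   Context: Logs share a base; $h_b$ is binary entropy; $\bar j$ is the other index. The family (integers $a,k\ge2$, even $\eta\ge6$): $\mathcal{S}_1=\mathcal{S}_2=\{0,\dots,a-1\}^k$ with pmf $\mathbb{W}(c,d)=\frac{k-1}{k}$ if $c=d=0^k$; $\frac{a^{\eta k}-1}{ka^{\eta k}(a^k-1)}$ if $c=d\ne0^k$; $\frac{1}{ka^{\eta k}(a^k-1)}$ if $c=0^k,d\ne0^k$; $0$ otherwise. IC: encoder $j$ inputs $(z_j,x_j)\in\mathcal{A}\times\mathcal{X}_j$ with $\mathcal{A}=\{0,\dots,a-1\}$; receiver $j$ observes $(y_0,y_j)\in\mathcal{A}\times\mathcal{Y}_j$, $y_0$ identical at both receivers; transition pmf $W_0(y_0|z_1,z_2)W_{Y_1|X_1}(y_1|x_1)W_{Y_2|X_2}(y_2|x_2)$, with $W_0(y_0|z_1,z_2)=1$ if $y_0=z_1=z_2$, $=1$ if $z_1\ne z_2,y_0=0$, $0$ otherwise. Satellite channels $W_{Y_j|X_j}$ are DMCs with capacities $C_I$ ($j=1$) and $C_I+h_b(\frac{2}{ka^{\eta k}})$ ($j=2$), $C_I=h_b(2/k)+\frac2k\log a$; for sufficiently large $a,k$, $|\mathcal{Y}_j|\le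 a^{5/(2k)}$. Transmissibility over the IC: for every $\epsilon>0$ there is $N_\epsilon$ such that for all $n\ge N_\epsilon$ there exist encoders $e_j:\mathcal{S}_j^n\to(\text{input alphabet}_j)^n$ and decoders $d_j$ from receiver $j$'s output sequences to $\mathcal{S}_j^n$ with $P(d_1\ne S_1^n\text{ or }d_2\ne S_2^n)\le\epsilon$ under memoryless sources and channel. Liu–Chen conditions (for sources with trivial Gács–Körner–Witsenhausen common part, as here), with channel inputs $X_j$ and outputs $Y_j$: there exist finite $\mathcal{W}_1,\mathcal{W}_2,\mathcal{Q}$ and a pmf $\mathbb{W}_{S_1S_2}p_Qp_{W_1|Q}p_{W_2|Q}p_{X_1|QW_1S_1}p_{X_2|QW_2S_2}\mathbb{W}_{Y_1Y_2|X_1X_2}$ with, for $j\in\{1,2\}$, $W=(W_1,W_2)$: $H(S_j)<I(S_j,X_j;Y_j|Q,W_{\bar j})$; $H(S_1)+H(S_2)<\min_j\{I(S_j,X_j;Y_j|Q,W)+I(W_j,S_{\bar j},X_{\bar j};Y_{\bar j}|Q)\}$; $H(S_1)+H(S_2)<\sum_jI(S_j,W_{\bar j},X_j;Y_j|Q,W_j)$; $2H(S_j)+H(S_{\bar j})<I(S_j,X_j;Y_j|Q,W)+I(S_j,W_{\bar j},X_j;Y_j|Q)+I(S_{\bar j},W_j,X_{\bar j};Y_j|Q,W_j)$. (For this IC, $X_j$ stands for the pair $(z_j,x_j)$ and $Y_j$ for $(y_0,y_j)$.) *)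

(* Defs.v *)
From HB Require Import structures.
From mathcomp Require Import all_boot all_order all_algebra.
From mathcomp Require Import all_classical all_reals exp.
Set Implicit Arguments. Unset Strict Implicit. Unset Printing Implicit Defensive.
Import Order.TTheory GRing.Theory Num.Theory.
Local Open Scope ring_scope.

Section InfoTheory.
Variable R : realType.

Definition is_pmf (T : finType) (p : T -> R) : Prop :=
  (forall t, 0 <= p t) /\ \sum_(t : T) p t = 1.

Definition is_channel (X Y : finType) (W : X -> Y -> R) : Prop :=
  forall x, is_pmf (W x).

Definition plogp (q : R) : R := if q == 0 then 0 else q * ln q.

Definition law (Om T : finType) (P : Om -> R) (X : Om -> T) (t : T) : R :=
  \sum_(w : Om | X w == t) P w.

Definition ent (Om T : finType) (P : Om -> R) (X : Om -> T) : R :=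
  - \sum_(t : T) plogp (law P X t).

Definition cmi (Om T U V : finType) (P : Om -> R)
  (X : Om -> T) (Y : Om -> U) (Z : Om -> V) : R :=
  ent P (fun w => (X w, Z w)) + ent P (fun w => (Y w, Z w))
  - ent P (fun w => (X w, Y w, Z w)) - ent P Z.

Definition hb (x : R) : R := - plogp x - plogp (1 - x).

Definition mi_ch (X Y : finType) (p : X -> R) (W : X -> Y -> R) : R :=
  cmi (fun xy : X * Y => p xy.1 * W xy.1 xy.2)
      (fun xy => xy.1) (fun xy => xy.2) (fun _ => tt).

Definition is_capacity (X Y : finType) (W : X -> Y -> R) (C : R) : Prop :=
  (forall p, is_pmf p -> mi_ch p W <= C) /\
  (forall e, 0 < e -> exists p, is_pmf p /\ C - e < mi_ch p W).

Definition LC_joint (S1 S2 Q W1 W2 X1 X2 Y1 Y2 : finType)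
  (pS : S1 -> S2 -> R) (pQ : Q -> R) (pW1 : Q -> W1 -> R) (pW2 : Q -> W2 -> R)
  (pX1 : Q -> W1 -> S1 -> X1 -> R) (pX2 : Q -> W2 -> S2 -> X2 -> R)
  (Wc : X1 -> X2 -> Y1 -> Y2 -> R)
  (o : S1 * S2 * Q * W1 * W2 * X1 * X2 * Y1 * Y2) : R :=
  let '(s1, s2, q, w1, w2, x1, x2, y1, y2) := o in
  pS s1 s2 * pQ q * pW1 q w1 * pW2 q w2 * pX1 q w1 s1 x1 * pX2 q w2 s2 x2
  * Wc x1 x2 y1 y2.

Definition LiuChen (S1 S2 X1 X2 Y1 Y2 : finType) (pS : S1 -> S2 -> R)
  (Wc : X1 -> X2 -> Y1 -> Y2 -> R) : Prop :=
  exists (Q W1 W2 : finType) (pQ : Q -> R) (pW1 : Q -> W1 -> R)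
         (pW2 : Q -> W2 -> R) (pX1 : Q -> W1 -> S1 -> X1 -> R)
         (pX2 : Q -> W2 -> S2 -> X2 -> R),
  is_pmf pQ /\ (forall q, is_pmf (pW1 q)) /\ (forall q, is_pmf (pW2 q)) /\
  (forall q w s, is_pmf (pX1 q w s)) /\ (forall q w s, is_pmf (pX2 q w s)) /\
  let P := LC_joint pS pQ pW1 pW2 pX1 pX2 Wc in
  let S1v := fun o : S1 * S2 * Q * W1 * W2 * X1 * X2 * Y1 * Y2 =>
               let '(s1, _, _, _, _, _, _, _, _) := o in s1 in
  let S2v := fun o : S1 * S2 * Q * W1 * W2 * X1 * X2 * Y1 * Y2 =>
               let '(_, s2, _, _, _, _, _, _, _) := o in s2 in
  let Qv := fun o : S1 * S2 * Q * W1 * W2 * X1 * X2 * Y1 * Y2 =>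
               let '(_, _, q, _, _, _, _, _, _) := o in q in
  let W1v := fun o : S1 * S2 * Q * W1 * W2 * X1 * X2 * Y1 * Y2 =>
               let '(_, _, _, w1, _, _, _, _, _) := o in w1 in
  let W2v := fun o : S1 * S2 * Q * W1 * W2 * X1 * X2 * Y1 * Y2 =>
               let '(_, _, _, _, w2, _, _, _, _) := o in w2 in
  let X1v := fun o : S1 * S2 * Q * W1 * W2 * X1 * X2 * Y1 * Y2 =>
               let '(_, _, _, _, _, x1, _, _, _) := o in x1 in
  let X2v := fun o : S1 * S2 * Q * W1 * W2 * X1 * X2 * Y1 * Y2 =>
               let '(_, _, _, _, _, _, x2, _, _) := o in x2 in
  let Y1v := fun o : S1 * S2 * Q * W1 * W2 * X1 * X2 * Y1 * Y2 =>
               let '(_, _, _, _, _, _, _, y1, _) := o in y1 in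
  let Y2v := fun o : S1 * S2 * Q * W1 * W2 * X1 * X2 * Y1 * Y2 =>
               let '(_, _, _, _, _, _, _, _, y2) := o in y2 in
  let Wv := fun o => (W1v o, W2v o) in
  let HS1 := ent P S1v in
  let HS2 := ent P S2v in
  HS1 < cmi P (fun o => (S1v o, X1v o)) Y1v (fun o => (Qv o, W2v o)) /\
  HS2 < cmi P (fun o => (S2v o, X2v o)) Y2v (fun o => (Qv o, W1v o)) /\
  HS1 + HS2 < cmi P (fun o => (S1v o, X1v o)) Y1v (fun o => (Qv o, Wv o))
              + cmi P (fun o => (W1v o, S2v o, X2v o)) Y2v Qv /\
  HS1 + HS2 < cmi P (fun o => (S2v o, X2v o)) Y2v (fun o => (Qv o, Wv o))
              + cmi P (fun o => (W2v o, S1v o, X1v o)) Y1v Qv /\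
  HS1 + HS2 < cmi P (fun o => (S1v o, W2v o, X1v o)) Y1v (fun o => (Qv o, W1v o))
              + cmi P (fun o => (S2v o, W1v o, X2v o)) Y2v (fun o => (Qv o, W2v o)) /\
  2 * HS1 + HS2 < cmi P (fun o => (S1v o, X1v o)) Y1v (fun o => (Qv o, Wv o))
                  + cmi P (fun o => (S1v o, W2v o, X1v o)) Y1v Qv
                  + cmi P (fun o => (S2v o, W1v o, X2v o)) Y1v (fun o => (Qv o, W1v o)) /\
  2 * HS2 + HS1 < cmi P (fun o => (S2v o, X2v o)) Y2v (fun o => (Qv o, Wv o))
                  + cmi P (fun o => (S2v o, W1v o, X2v o)) Y2v Qv
                  + cmi P (fun o => (S1v o, W2v o, X1v o)) Y2v (fun o => (Qv o, W2v o)).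

Definition block_err (S1 S2 X1 X2 Y1 Y2 : finType) (n : nat)
  (pS : S1 -> S2 -> R) (Wc : X1 -> X2 -> Y1 -> Y2 -> R)
  (e1 : {ffun 'I_n -> S1} -> {ffun 'I_n -> X1})
  (e2 : {ffun 'I_n -> S2} -> {ffun 'I_n -> X2})
  (d1 : {ffun 'I_n -> Y1} -> {ffun 'I_n -> S1})
  (d2 : {ffun 'I_n -> Y2} -> {ffun 'I_n -> S2}) : R :=
  \sum_(s1 : {ffun 'I_n -> S1}) \sum_(s2 : {ffun 'I_n -> S2})
    (\prod_(i < n) pS (s1 i) (s2 i)) *
    \sum_(y1 : {ffun 'I_n -> Y1}) \sum_(y2 : {ffun 'I_n -> Y2})
      (\prod_(i < n) Wc (e1 s1 i) (e2 s2 i) (y1 i) (y2 i)) *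
      (if (d1 y1 != s1) || (d2 y2 != s2) then 1 else 0).

Definition transmissible (S1 S2 X1 X2 Y1 Y2 : finType) (pS : S1 -> S2 -> R)
  (Wc : X1 -> X2 -> Y1 -> Y2 -> R) : Prop :=
  forall eps : R, 0 < eps -> exists N : nat, forall n : nat, (N <= n)%N ->
    exists e1 e2 d1 d2, block_err (n := n) pS Wc e1 e2 d1 d2 <= eps.

Definition is_zero_word (a k : nat) (c : {ffun 'I_k -> 'I_a}) : bool :=
  [forall i, val (c i) == 0%N].

Definition src_fam (a k eta : nat) (c d : {ffun 'I_k -> 'I_a}) : R :=
  let A := (a%:R : R) ^+ (eta * k) in
  if is_zero_word c && is_zero_word d then (k%:R - 1) / k%:R
  else if (c == d) && ~~ is_zero_word c then
         (A - 1) / (k%:R * A * ((a%:R : R) ^+ k - 1))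
  else if is_zero_word c && ~~ is_zero_word d then
         1 / (k%:R * A * ((a%:R : R) ^+ k - 1))
  else 0.

Definition W0 (a : nat) (z1 z2 y0 : 'I_a) : R :=
  if z1 == z2 then (if y0 == z1 then 1 else 0)
  else (if val y0 == 0%N then 1 else 0).

Definition ic_fam (a : nat) (X1 X2 Y1 Y2 : finType)
  (Ws1 : X1 -> Y1 -> R) (Ws2 : X2 -> Y2 -> R)
  (u1 : 'I_a * X1) (u2 : 'I_a * X2) (v1 : 'I_a * Y1) (v2 : 'I_a * Y2) : R :=
  (if v1.1 == v2.1 then 1 else 0) * W0 u1.1 u2.1 v1.1 * Ws1 u1.2 v1.2 * Ws2 u2.2 v2.2.

Definition C_I (a k : nat) : R := hb (2 / k%:R) + 2 / k%:R * ln (a%:R : R).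

End InfoTheory.
Arguments ic_fam {R} a {X1 X2 Y1 Y2} Ws1 Ws2 u1 u2 v1 v2.

(* Main.v *)
Require Import Defs.
From HB Require Import structures.
From mathcomp Require Import all_boot all_order all_algebra.
From mathcomp Require Import all_classical all_reals sequences exp.
From mathcomp Require Import ring lra.
Set Implicit Arguments. Unset Strict Implicit. Unset Printing Implicit Defensive.
Import Order.TTheory GRing.Theory Num.Theory.
Local Open Scope ring_scope.

(* The first Liu-Chen condition already fails.  It would bound H(S_1), which is at
   least (1 - 1/A) log a with A = a^(eta k), by H(Y_0, Y_1 | Q, W_2).  With
   probability 1 - 1/k we have S_2 = 0, hence S_1 = 0, and then z_1 and z_2 are
   independent given (Q, W_1, W_2); two independent letters rarely agree on many
   values, so Y_0 carries O(1) nats and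
   H(Y_0, Y_1 | Q, W_2) <= log |Y_1| + (1/k) log a + O(1).

   Conversely, cut the sources into blocks of length l = k^3.  Both blocks agree
   except with probability l / (k A), so the same code applied by both encoders
   transmits l letters through Y_0; it describes the nonzero words given their
   positions, up to a fluctuation of order k^2 letters.  The positions, the overflow
   and the rare failures cost less than l C_I nats per block, and they are sent over
   the satellite channels by random coding of the whole sequence, the receiver using
   the decoded Y_0 as side information. *)

(** * Product measures *)

(** A nonzero word is worth about [k log a] nats and occurs with frequency [1/k], so the sources
    share about one letter per channel use, which is what [Y_0] can carry. A single-letter scheme
    coordinates the two inputs only at the rare times when the word is nonzero; a block code spreads
    each word over the idle times. This is the gap between the two halves.

    The obstacle for coding is that neither encoder knows whether the two blocks agree, so [Y_0] is
    side information of unknown reliability. It therefore enters only through a guess: a positive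
    weight on source blocks given [Y_0], of total at most one, whose mean negative logarithm is the
    rate that the satellite channel must supply. Mixing in the uniform law keeps this rate finite
    when the blocks differ. The guess charges positions at frequency [2/k], twice the true one, to
    match the term [hb (2/k)] of [C_I]; the other term, [2/k log a], pays for overflow and
    failures. *)

Section ProductMeasure.
Variable R : realType.

Definition iid (I T : finType) (p : T -> R) (s : {ffun I -> T}) : R :=
  \prod_i p (s i).

Lemma iid_ge0 (I T : finType) (p : T -> R) (s : {ffun I -> T}) :
  (forall t, 0 <= p t) -> 0 <= iid p s.
Proof. by move=> p0; apply: prodr_ge0. Qed.

Lemma sum_iid_prod (I T : finType) (p : T -> R) (h : I -> T -> R) :
  \sum_(s : {ffun I -> T}) iid p s * \prod_i h i (s i)
  = \prod_i \sum_t p t * h i t.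
Proof.
rewrite bigA_distr_bigA; apply: eq_bigr => s _.
by rewrite -big_split.
Qed.

Lemma is_pmf_iid (I T : finType) (p : T -> R) :
  is_pmf p -> is_pmf (@iid I T p).
Proof.
move=> [p0 p1]; split=> [s|]; first exact: iid_ge0.
transitivity (\sum_(s : {ffun I -> T}) iid p s * \prod_(i : I) 1).
  by apply: eq_bigr => s _; rewrite big1 ?mulr1.
rewrite (sum_iid_prod p (fun _ _ => 1)) big1 // => i _.
by under eq_bigr do rewrite mulr1.
Qed.

(** Treats equal and independent coordinates together. It gives the variance of a sum, and in random
    coding the independence of two distinct codewords. *)
Lemma sum_iid_at2 (I T : finType) (p : T -> R) (f h : T -> R) (i j : I) :
  \sum_t p t = 1 ->
  \sum_(s : {ffun I -> T}) iid p s * (f (s i) * h (s j))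
  = if i == j then \sum_t p t * (f t * h t)
    else (\sum_t p t * f t) * (\sum_t p t * h t).
Proof.
move=> p1.
pose w i' t := (if i' == i then f t else 1) * (if i' == j then h t else 1).
have prodw (s : {ffun I -> T}) : f (s i) * h (s j) = \prod_i' w i' (s i').
  by rewrite big_split /= -!big_mkcond !big_pred1_eq.
under eq_bigr do rewrite prodw.
rewrite sum_iid_prod (bigD1 i) //= /w eqxx.
case: eqP => [<-|/eqP neq].
  rewrite [X in _ * X]big1 ?mulr1 // => i' /negPf ->.
  by under eq_bigr do rewrite !mulr1.
under eq_bigr do rewrite mulr1.
have neq' : j != i by rewrite eq_sym.
rewrite (bigD1 j) //= eqxx (negPf neq').
congr (_ * _).
rewrite [X in _ * X]big1 ?mulr1.
  by under eq_bigr do rewrite mul1r.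
move=> i' /andP[/negPf -> /negPf ->].
by under eq_bigr do rewrite !mulr1.
Qed.

Lemma sum_iid_at (I T : finType) (p : T -> R) (f : T -> R) (i : I) :
  \sum_t p t = 1 ->
  \sum_(s : {ffun I -> T}) iid p s * f (s i) = \sum_t p t * f t.
Proof.
move=> p1; have := sum_iid_at2 f (fun _ => 1) i i p1.
rewrite eqxx; under eq_bigr do rewrite mulr1.
by move->; under eq_bigr do rewrite mulr1.
Qed.

Lemma sum_iid_sum (I T : finType) (p : T -> R) (f : T -> R) :
  \sum_t p t = 1 ->
  \sum_(s : {ffun I -> T}) iid p s * (\sum_i f (s i))
  = #|I|%:R * \sum_t p t * f t.
Proof.
move=> p1; under eq_bigr do rewrite mulr_sumr.
rewrite exchange_big /= -sum1_card natr_sum mulr_suml.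
by apply: eq_bigr => i _; rewrite mul1r sum_iid_at.
Qed.

Lemma sum_iid_sqr (I T : finType) (p : T -> R) (f : T -> R) :
  \sum_t p t = 1 -> \sum_t p t * f t = 0 ->
  \sum_(s : {ffun I -> T}) iid p s * (\sum_i f (s i)) ^+ 2
  = #|I|%:R * \sum_t p t * f t ^+ 2.
Proof.
move=> p1 f0.
under eq_bigr do rewrite expr2 mulr_suml mulr_sumr.
rewrite exchange_big /=.
transitivity (\sum_(i : I) \sum_t p t * f t ^+ 2); last first.
  by rewrite -sum1_card natr_sum mulr_suml; apply: eq_bigr => i _; rewrite mul1r.
apply: eq_bigr => i _.
under eq_bigr do rewrite !mulr_sumr.
rewrite exchange_big /= (bigD1 i) //= sum_iid_at2 // eqxx.
rewrite [X in _ + X]big1 ?addr0 // => j neq.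
by rewrite sum_iid_at2 // eq_sym (negPf neq) f0 mul0r.
Qed.

Lemma chebyshev_iid (I T : finType) (p f : T -> R) (mu delta : R) :
  is_pmf p -> mu = \sum_t p t * f t -> 0 < delta -> (0 < #|I|)%N ->
  \sum_(s : {ffun I -> T})
     iid p s * (#|I|%:R * delta <= `|\sum_i f (s i) - #|I|%:R * mu|)%R%:R
  <= (\sum_t p t * (f t - mu) ^+ 2) / (delta ^+ 2 * #|I|%:R).
Proof.
move=> [p0 p1] muE d0 I0.
have n0 : 0 < #|I|%:R :> R by rewrite ltr0n.
have cent : \sum_t p t * (f t - mu) = 0.
  under eq_bigr do rewrite mulrBr.
  by rewrite big_split /= sumrN -mulr_suml p1 mul1r -muE subrr.
have sq := sum_iid_sqr I p1 cent.
have -> : (\sum_t p t * (f t - mu) ^+ 2) / (delta ^+ 2 * #|I|%:R)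
  = \sum_(s : {ffun I -> T}) iid p s *
     ((\sum_i (f (s i) - mu)) ^+ 2 / (#|I|%:R * delta) ^+ 2).
  under [RHS]eq_bigr do rewrite mulrA.
  rewrite -mulr_suml sq.
  set v := \sum_t _; field.
  by rewrite gt_eqF //= gt_eqF.
apply: ler_sum => s _; apply: ler_wpM2l; first exact: iid_ge0.
have -> : \sum_i (f (s i) - mu) = \sum_i f (s i) - #|I|%:R * mu.
  by rewrite sumrB sumr_const mulr_natl.
set x := _ - _.
have [h|_] /= := boolP (#|I|%:R * delta <= `|x|); last first.
  by rewrite divr_ge0 // sqr_ge0.
rewrite ler_pdivlMr ?mul1r; last by rewrite exprn_gt0 // mulr_gt0.
rewrite -[x ^+ 2]real_normK ?num_real // lerXn2r // nnegrE //.
by rewrite mulr_ge0 // ltW.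
Qed.

(** An injective [phi] selects disjoint blocks; coordinates outside its range sum out to one, so a
    length that is not a multiple of the block length does no harm. *)
Lemma sum_iid_blocks (I B J T : finType) (p : T -> R) (phi : B -> J -> I)
    (G : {ffun B -> {ffun J -> T}} -> R) :
  (forall b b' j j', phi b j = phi b' j' -> (b, j) = (b', j')) ->
  \sum_t p t = 1 ->
  \sum_(s : {ffun I -> T}) iid p s * G [ffun b => [ffun j => s (phi b j)]]
  = \sum_(u : {ffun B -> {ffun J -> T}}) iid (@iid J T p) u * G u.
Proof.
move=> phi_inj p1.
pose rs (s : {ffun I -> T}) := [ffun b => [ffun j => s (phi b j)]].
rewrite (partition_big rs xpredT) //=; apply: eq_bigr => u _.
transitivity ((\sum_(s | rs s == u) iid p s) * G u).
  by rewrite mulr_suml; apply: eq_bigr => s /eqP <-.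
congr (_ * _).
(* The fibre over [u] is a product set: [F i] restricts coordinate [i] only if it lies in a block.
   Hence the sum over the fibre factors. *)
pose F i t := [forall bj : B * J, (phi bj.1 bj.2 == i) ==> (t == u bj.1 bj.2)].
transitivity (\sum_(s in family F) iid p s).
  apply: eq_bigl => s; apply/eqP/familyP => [e i|Fs].
    rewrite /F -e; by apply/forallP => -[b j] /=; apply/implyP => /eqP <-; rewrite !ffunE.
  apply/ffunP => b; apply/ffunP => j; rewrite !ffunE.
  by have /forallP/(_ (b, j))/= := Fs (phi b j); rewrite eqxx => /eqP.
rewrite /iid -(bigA_distr_big_dep _ (fun i t => p t)).
pose psi (bj : B * J) := phi bj.1 bj.2.
rewrite (bigID (mem (psi @: [set: B * J]))) /= [X in _ * X]big1 ?mulr1; last first.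
  move=> i ni; rewrite -[RHS]p1; apply: eq_bigl => t.
  apply/forallP => -[b j] /=; apply/implyP => /eqP e.
  exfalso; move/negP: ni; apply; apply/imsetP.
  by apply: (ex_intro2 _ _ (b, j)); rewrite ?inE // -e.
rewrite big_imset /=; last first.
  by move=> [b j] [b' j'] _ _ /= /phi_inj.
rewrite pair_big /=; apply: eq_big => [x|[b j] _]; first by rewrite inE.
apply: big_pred1 => t; apply/forallP/eqP => /= [/(_ (b, j))/=|-> [b' j']].
  by rewrite eqxx => /eqP.
by apply/implyP => /eqP/phi_inj [-> ->].
Qed.

Lemma sum_ffun_pair (I T U : finType) (F : {ffun I -> T} -> {ffun I -> U} -> R) :
  \sum_(s : {ffun I -> T * U}) F [ffun i => (s i).1] [ffun i => (s i).2]
  = \sum_t \sum_u F t u.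
Proof.
rewrite pair_big /=.
pose h (x : {ffun I -> T} * {ffun I -> U}) := [ffun i => (x.1 i, x.2 i)].
rewrite (reindex h); last first.
  exists (fun s : {ffun I -> T * U} => ([ffun i => (s i).1], [ffun i => (s i).2])).
    by move=> [t u] _; congr pair; apply/ffunP => i; rewrite !ffunE.
  by move=> s _; apply/ffunP => i; rewrite !ffunE -surjective_pairing.
by apply: eq_bigr => -[t u] _; congr F; apply/ffunP => i; rewrite !ffunE.
Qed.

End ProductMeasure.

(** * Joint source-channel coding with side information *)

Section OneShot.
Variable R : realType.

Definition output_law (X Y : finType) (q : X -> R) (W : X -> Y -> R) (y : Y) : R :=
  \sum_x q x * W x y.

(** Used to extract one good codebook from an average over random ones. *)
Lemma exists_le_mean (T : finType) (p f : T -> R) (b : R) :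
  is_pmf p -> \sum_t p t * f t <= b -> exists t, f t <= b.
Proof.
move=> [p0 p1] le_b.
have [//|/forallNP gtb] := pselect (exists t, f t <= b).
have gt0 t : 0 <= p t * (f t - b).
  by rewrite mulr_ge0 // subr_ge0 ltW // ltNge; apply/negP/gtb.
have : \sum_t p t * (f t - b) <= 0.
  under eq_bigr do rewrite mulrBr.
  by rewrite big_split /= sumrN -mulr_suml p1 mul1r subr_le0.
rewrite le_eqVlt ltNge sumr_ge0 // orbF psumr_eq0 // => /allP all0.
suff p10 : \sum_t p t = 0 by move/eqP: p10; rewrite p1 oner_eq0.
apply: big1 => t _; have := all0 t (mem_index_enum t).
rewrite mulf_eq0 => /orP[/eqP//|]; rewrite subr_eq0 => /eqP e.
by have := gtb t; rewrite e lexx.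
Qed.

(* Random coding: codewords are drawn from [q], and the decoder looks for a message
   whose guess times likelihood exceeds [beta] times the output probability. *)
Lemma one_shot (O T V X Y : finType) (P : O -> R) (t : O -> T) (v : O -> V)
    (q : X -> R) (W : X -> Y -> R) (g : T -> V -> R) (K beta : R) :
  (forall o, 0 <= P o) -> \sum_o P o = 1 -> is_pmf q -> is_channel W ->
  (forall t v, 0 <= g t v) -> (forall v, \sum_t g t v <= K) -> 0 < beta ->
  exists (enc : T -> X) (dec : V -> Y -> T),
    \sum_o P o * \sum_y W (enc (t o)) y * (dec (v o) y != t o)%:R
    <= \sum_o P o * \sum_x \sum_y q x * W x y *
         (g (t o) (v o) * W x y <= beta * output_law q W y)%R%:R
       + K / beta.
Proof.
move=> P0 P1 [q0 q1] Wch g0 gK b0.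
have [o0 _] : exists o : O, True.
  case: (pickP (fun _ : O => true)) => [o _|no]; first by exists o.
  by move: P1; rewrite big_pred0 // => /esym/eqP; rewrite oner_eq0.
pose Q := output_law q W.
have Q0 y : 0 <= Q y.
  by apply: sumr_ge0 => x _; rewrite mulr_ge0 //; case: (Wch x).
have Q1 : \sum_y Q y = 1.
  rewrite exchange_big /= -q1; apply: eq_bigr => x _.
  by rewrite -mulr_sumr; case: (Wch x) => _ ->; rewrite mulr1.
pose good t' v' x y := ~~ (g t' v' * W x y <= beta * Q y).
pose dec (C : {ffun T -> X}) v' y :=
  odflt (t o0) [pick t' | good t' v' (C t') y].
pose err (C : {ffun T -> X}) :=
  \sum_o P o * \sum_y W (C (t o)) y * (dec C (v o) y != t o)%:R.
suff : \sum_C iid q C * err C <=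
    \sum_o P o * \sum_x \sum_y q x * W x y * (~~ good (t o) (v o) x y)%:R + K / beta.
  move/(exists_le_mean (is_pmf_iid T (conj q0 q1))) => [C leC].
  exists (fun t => C t), (dec C); apply: le_trans leC _.
  rewrite lerD2r; apply: ler_sum => o _; apply: ler_wpM2l => //.
  apply: ler_sum => x _; apply: ler_sum => y _.
  by rewrite /good negbK.
(* Union bound: the decoder errs only if the sent message fails the test or another message passes
   it. *)
have err_le C : err C <= \sum_o P o * \sum_y
    (W (C (t o)) y * (~~ good (t o) (v o) (C (t o)) y)%:R +
     \sum_(t' | t' != t o) W (C (t o)) y * (good t' (v o) (C t') y)%:R).
  apply: ler_sum => o _; apply: ler_wpM2l => //.
  apply: ler_sum => y _; rewrite -mulr_sumr -mulrDr.
  apply: ler_wpM2l; first by case: (Wch (C (t o))).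
  have s0 : 0 <= \sum_(t' | t' != t o) (good t' (v o) (C t') y)%:R :> R.
    by apply: sumr_ge0.
  case gt : (good (t o) (v o) (C (t o)) y) => /=; last first.
    by case: (_ != _); rewrite ?lerDl // addr_ge0.
  rewrite add0r /dec; case: pickP => [t' gt'|/(_ (t o))]; last by rewrite gt.
  case: (eqVneq t' (t o)) => //= neq.
  by rewrite (bigD1 t') //= gt' lerDl sumr_ge0.
apply: (@le_trans _ _ (\sum_C iid q C * \sum_o P o * \sum_y
    (W (C (t o)) y * (~~ good (t o) (v o) (C (t o)) y)%:R +
     \sum_(t' | t' != t o) W (C (t o)) y * (good t' (v o) (C t') y)%:R))).
  by apply: ler_sum => C _; apply: ler_wpM2l => //; apply: iid_ge0.
under eq_bigr do rewrite mulr_sumr.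
have -> : K / beta = \sum_o P o * (K / beta) by rewrite -mulr_suml P1 mul1r.
rewrite exchange_big -big_split /=.
apply: ler_sum => o _.
under [leLHS]eq_bigr do rewrite mulrCA.
rewrite -mulr_sumr -mulrDr; apply: ler_wpM2l => //.
under [leLHS]eq_bigr do rewrite mulr_sumr.
rewrite exchange_big /= [X in _ <= X + _]exchange_big /=.
have -> : K / beta = \sum_y Q y * (K / beta) by rewrite -mulr_suml Q1 mul1r.
rewrite -big_split /=.
apply: ler_sum => y _.
under [leLHS]eq_bigr do rewrite mulrDr.
rewrite big_split /=; apply: lerD.
  rewrite (sum_iid_at (fun x => W x y * (~~ good (t o) (v o) x y)%:R)) //.
  by apply: ler_sum => x _; rewrite mulrA.
under [leLHS]eq_bigr do rewrite mulr_sumr.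
rewrite exchange_big /=.
apply: (@le_trans _ _ (\sum_(t' | t' != t o) Q y * (g t' (v o) / beta))); last first.
  rewrite -mulr_sumr; apply: ler_wpM2l => //.
  rewrite -mulr_suml; apply: ler_wpM2r; first by rewrite invr_ge0 ltW.
  apply: le_trans (gK (v o)); rewrite [leRHS](bigD1 (t o)) //=.
  by rewrite lerDr.
apply: ler_sum => t' neq.
(* The competing codeword is independent of the sent one, so averaging replaces the likelihood of
   the sent one by the output law [Q y]. *)
rewrite (sum_iid_at2 (fun x => W x y) (fun x => (good t' (v o) x y)%:R)) //.
rewrite eq_sym (negPf neq).
have -> : \sum_x q x * W x y = Q y by [].
(* Markov's inequality, kept multiplied by [Q y], which may vanish *)
have [->|Qn0] := eqVneq (Q y) 0; first by rewrite !mul0r.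
have Qgt0 : 0 < Q y by rewrite lt0r Qn0 Q0.
apply: ler_wpM2l => //; rewrite ler_pdivlMr // -(ler_pM2r Qgt0) -mulrA.
rewrite mulr_suml [leRHS]mulr_sumr; apply: ler_sum => x _.
rewrite [leRHS]mulrCA -mulrA; apply: ler_wpM2l => //.
rewrite /good -ltNge; case: ltP => [lt|_]; first by rewrite mul1r ltW.
by rewrite mul0r mulr_ge0 //; case: (Wch x).
Qed.

End OneShot.

(** * Entropy and mutual information as expectations of logarithms *)

Section MutualInformation.
Variable R : realType.

Lemma lawE (O T : finType) (P : O -> R) (X : O -> T) (t : T) :
  law P X t = \sum_o P o * (X o == t)%:R.
Proof.
rewrite /law big_mkcond; apply: eq_bigr => o _.
by case: eqP; rewrite ?mulr1 ?mulr0.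
Qed.

Lemma entE (O T : finType) (P : O -> R) (X : O -> T) :
  ent P X = - \sum_o P o * ln (law P X (X o)).
Proof.
rewrite /ent; congr (- _).
rewrite [RHS](partition_big X xpredT) //=; apply: eq_bigr => t _.
transitivity (law P X t * ln (law P X t)).
  by rewrite /plogp; case: eqP => // ->; rewrite mul0r.
by rewrite mulr_suml; apply: eq_bigr => o /eqP ->.
Qed.

Lemma output_law_gt0 (X Y : finType) (q : X -> R) (W : X -> Y -> R) (x : X) (y : Y) :
  is_pmf q -> is_channel W -> 0 < q x * W x y -> 0 < output_law q W y.
Proof.
move=> [q0 _] Wch qW; rewrite /output_law (bigD1 x) //= ltr_wpDr //.
by apply: sumr_ge0 => x' _; rewrite mulr_ge0 //; case: (Wch x').
Qed.

(** Exhibits the mutual information as the mean of the information density, the quantity that the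
    decoding test thresholds. *)
Lemma mi_chE (X Y : finType) (q : X -> R) (W : X -> Y -> R) :
  is_pmf q -> is_channel W ->
  mi_ch q W = \sum_(xy : X * Y) q xy.1 * W xy.1 xy.2 *
                (ln (W xy.1 xy.2) - ln (output_law q W xy.2)).
Proof.
move=> qp Wch; have [q0 q1] := qp.
rewrite /mi_ch /cmi !entE /= -!sumrN -!big_split /=.
set P := fun xy : X * Y => q xy.1 * W xy.1 xy.2.
have lX x : law P (fun w => (w.1, tt)) (x, tt) = q x.
  rewrite lawE -(pair_bigA _ (fun a b => P (a, b) * ((a, tt) == (x, tt))%:R)) /=.
  rewrite (bigD1 x) //= [X in _ + X]big1 ?addr0; last first.
    move=> x' nx; apply: big1 => y _.
    by rewrite xpair_eqE (negPf nx) mulr0.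
  under eq_bigr do rewrite eqxx mulr1.
  by rewrite /P /= -mulr_sumr; case: (Wch x) => _ ->; rewrite mulr1.
have lY y : law P (fun w => (w.2, tt)) (y, tt) = output_law q W y.
  rewrite lawE -(pair_bigA _ (fun a b => P (a, b) * ((b, tt) == (y, tt))%:R)) /=.
  apply: eq_bigr => x _.
  rewrite (bigD1 y) //= [X in _ + X]big1 ?addr0 ?eqxx ?mulr1 //.
  by move=> y' ny; rewrite xpair_eqE (negPf ny) mulr0.
have lXY xy : law P (fun w => (w.1, w.2, tt)) (xy, tt) = P xy.
  rewrite /law (big_pred1 xy) // => w.
  by rewrite -surjective_pairing xpair_eqE eqxx andbT.
have lT : law P (fun=> tt) tt = 1.
  rewrite /law -(pair_bigA _ (fun a b => P (a, b))) /= -q1.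
  apply: eq_bigr => x _; rewrite /P /= -mulr_sumr.
  by case: (Wch x) => _ ->; rewrite mulr1.
apply: eq_bigr => -[x y] _ /=; rewrite lX lY (lXY (x, y)) lT ln1 /P /=.
have [->|nz] := eqVneq (q x * W x y) 0; first by rewrite !mul0r; ring.
have qx : 0 < q x.
  by rewrite lt0r q0 andbT; apply: contraNneq nz => ->; rewrite mul0r.
have wx : 0 < W x y.
  rewrite lt0r; case: (Wch x) => -> _; rewrite andbT.
  by apply: contraNneq nz => ->; rewrite mulr0.
by rewrite lnM ?posrE //; ring.
Qed.

End MutualInformation.

(** * Cutting sequences into blocks *)

Section Blocks.

Lemma block_pos_subproof (n l : nat) (b : 'I_(n %/ l)) (j : 'I_l) :
  (b * l + j < n)%N.
Proof.
apply: leq_trans (leq_divM n l).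
by apply: (@leq_trans (b.+1 * l)); rewrite ?leq_mul2r ?ltn_ord ?orbT // mulSn addnC ltn_add2r.
Qed.

(** The last [n %% l] positions belong to no block. *)
Definition block_pos (n l : nat) (b : 'I_(n %/ l)) (j : 'I_l) : 'I_n :=
  Ordinal (block_pos_subproof b j).

Lemma block_pos_inj (n l : nat) (b b' : 'I_(n %/ l)) (j j' : 'I_l) :
  block_pos b j = block_pos b' j' -> (b, j) = (b', j').
Proof.
have l0 : (0 < l)%N by case: l j {b b' j'} => [[]|].
move=> /(congr1 val) /= e; congr pair; apply: val_inj => /=.
  have := congr1 (divn^~ l) e.
  by rewrite !divnMDl // !(divn_small (ltn_ord _)) !addn0.
have := congr1 (modn^~ l) e.
by rewrite !modnMDl !modn_small.
Qed.

Definition blocks (n l : nat) (T : finType) (s : {ffun 'I_n -> T}) :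
    {ffun 'I_(n %/ l) -> {ffun 'I_l -> T}} :=
  [ffun b => [ffun j => s (block_pos b j)]].

End Blocks.

(** * Random coding of long sequences with a blockwise guess *)

Section BlockCoding.
Variable R : realType.

Definition memoryless (X Y : finType) (n : nat) (W : X -> Y -> R)
    (x : {ffun 'I_n -> X}) (y : {ffun 'I_n -> Y}) : R :=
  \prod_i W (x i) (y i).

Lemma is_channel_memoryless (X Y : finType) (n : nat) (W : X -> Y -> R) :
  is_channel W -> is_channel (@memoryless X Y n W).
Proof.
move=> Wch x; split=> [y|]; first by apply: prodr_ge0 => i _; case: (Wch (x i)).
rewrite /memoryless -(bigA_distr_bigA (fun i y => W (x i) y)) big1 // => i _.
by case: (Wch (x i)).
Qed.

Lemma output_law_memoryless (X Y : finType) (n : nat) (q : X -> R)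
    (W : X -> Y -> R) (y : {ffun 'I_n -> Y}) :
  output_law (iid q) (memoryless W) y = \prod_i output_law q W (y i).
Proof.
rewrite /output_law bigA_distr_bigA; apply: eq_bigr => x _.
by rewrite -big_split.
Qed.

Lemma sum_memoryless_pair (X Y : finType) (n : nat) (q : X -> R) (W : X -> Y -> R)
    (F : {ffun 'I_n -> X * Y} -> R) :
  \sum_(s : {ffun 'I_n -> X * Y}) iid (fun xy => q xy.1 * W xy.1 xy.2) s * F s
  = \sum_x \sum_y iid q x * memoryless W x y * F [ffun i => (x i, y i)].
Proof.
rewrite -(sum_ffun_pair (fun x y => iid q x * memoryless W x y * F [ffun i => (x i, y i)])).
apply: eq_bigr => s _; congr (_ * F _).
  by rewrite /iid /memoryless -big_split; apply: eq_bigr => i _; rewrite !ffunE.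
by apply/ffunP => i; rewrite !ffunE -surjective_pairing.
Qed.

(** The product leaves fewer than [l] trailing letters free; they multiply the sum by at most
    [#|S| ^ l], a constant in [n]. *)
Lemma sum_prod_blocks_le (S V : finType) (n l : nat)
    (g : {ffun 'I_l -> S} -> {ffun 'I_l -> V} -> R) (v : {ffun 'I_n -> V}) :
  (0 < l)%N -> (0 < #|S|)%N -> (forall t v, 0 <= g t v) ->
  (forall v, \sum_t g t v <= 1) ->
  \sum_t \prod_b g (blocks l t b) (blocks l v b) <= #|S|%:R ^+ l.
Proof.
move=> l0 S0 g0 g1; set c : R := #|S|%:R.
have c1 : 1 <= c by rewrite ler1n.
have cn0 : c != 0 by rewrite gt_eqF // (lt_le_trans ltr01).
have u1 : \sum_(s : S) c^-1 = 1 by rewrite sumr_const -mulr_natl divff.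
(* Counting sequences is [c ^ n] times an expectation under the uniform law, to which the block
   formula applies. *)
have := @sum_iid_blocks R 'I_n 'I_(n %/ l) 'I_l S (fun=> c^-1) (@block_pos n l)
  (fun u => \prod_b g (u b) (blocks l v b)) (@block_pos_inj n l) u1.
rewrite (sum_iid_prod _ (fun b t => g t (blocks l v b))).
rewrite (_ : \sum_s _ = c ^- n * \sum_t \prod_b g (blocks l t b) (blocks l v b)); last first.
  rewrite mulr_sumr; apply: eq_bigr => s _; congr (_ * _).
  by rewrite /iid prodr_const card_ord exprVn.
move/(congr1 (fun x => c ^+ n * x)); rewrite mulrA divff ?expf_neq0 // mul1r => ->.
have le1 : \prod_(b : 'I_(n %/ l)) \sum_t iid (fun=> c^-1) t * g t (blocks l v b)
    <= \prod_(b : 'I_(n %/ l)) c ^- l.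
  apply: ler_prod => b _; rewrite sumr_ge0 /=; last first.
    by move=> t _; rewrite mulr_ge0 // iid_ge0 // => _; rewrite invr_ge0 ler0n.
  under eq_bigr do rewrite /iid prodr_const card_ord exprVn.
  rewrite -mulr_sumr -[leRHS]mulr1; apply: ler_wpM2l; last exact: g1.
  by rewrite invr_ge0 exprn_ge0 // ler0n.
apply: le_trans (_ : c ^+ n * (c ^- l) ^+ (n %/ l) <= _).
  rewrite ler_wpM2l ?exprn_ge0 ?ler0n //; apply: le_trans le1 _.
  by rewrite prodr_const card_ord.
rewrite -exprVn -exprM exprVn ler_pdivrMr ?exprn_gt0 ?(lt_le_trans ltr01) // -exprD.
apply: ler_weXn2l => //.
by rewrite addnC [(l * _)%N]mulnC {1}(divn_eq n l) leq_add2l ltnW // ltn_mod.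
Qed.

Lemma prod_expR_ln (I : finType) (f : I -> R) :
  (forall i, 0 < f i) -> \prod_i f i = expR (\sum_i ln (f i)).
Proof.
move=> f0; rewrite expR_sum; apply: eq_bigr => i _.
by rewrite lnK // posrE.
Qed.

(** [- ln g] acts as a code length. By Chebyshev, its sum over blocks and the information density
    over letters stay near their means, so [one_shot] succeeds once the mean length is below [l]
    times the mutual information. [N] is independent of [v]. *)
Lemma block_coding (O S V X Y : finType) (l : nat) (p : O -> R) (tS : O -> S)
    (g : {ffun 'I_l -> S} -> {ffun 'I_l -> V} -> R)
    (vb : {ffun 'I_l -> O} -> {ffun 'I_l -> V}) (q : X -> R) (W : X -> Y -> R) :
  (0 < l)%N -> is_pmf p -> is_pmf q -> is_channel W ->
  (forall t v, 0 < g t v) -> (forall v, \sum_t g t v <= 1) ->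
  - (\sum_o iid p o * ln (g [ffun j => tS (o j)] (vb o))) < l%:R * mi_ch q W ->
  forall eps, 0 < eps -> exists N : nat, forall n : nat, (N <= n)%N ->
  forall v : {ffun 'I_n -> O} -> {ffun 'I_n -> V},
  (forall o b, blocks l (v o) b = vb (blocks l o b)) ->
  exists (enc : {ffun 'I_n -> S} -> {ffun 'I_n -> X})
         (dec : {ffun 'I_n -> V} -> {ffun 'I_n -> Y} -> {ffun 'I_n -> S}),
    \sum_o iid p o * \sum_y memoryless W (enc [ffun i => tS (o i)]) y *
      (dec (v o) y != [ffun i => tS (o i)])%:R <= eps.
Proof.
move=> l0 pp qp Wch g0 g1 lt_rate eps eps0.
have [p0 p1] := pp; have [q0 q1] := qp.
have lr0 : 0 < l%:R :> R by rewrite ltr0n.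
pose fS (o : {ffun 'I_l -> O}) := ln (g [ffun j => tS (o j)] (vb o)).
pose mu := \sum_o iid p o * fS o.
have mu_le0 : mu <= 0.
  apply: sumr_le0 => o _; apply: mulr_ge0_le0; first exact: iid_ge0.
  apply: ln_le0; apply: le_trans (g1 (vb o)).
  by rewrite (bigD1 [ffun j => tS (o j)]) //= lerDl sumr_ge0 // => t _; apply: ltW.
pose I := mi_ch q W.
(* The gap of a block is cut into [l + 2] shares: [l] for the channel fluctuation, one for the
   source fluctuation, and one left over, half of which is the exponent of [beta]. *)
pose d := (l%:R * I + mu) / (l%:R + 2).
have Imu : 0 < l%:R * I + mu.
  have : - mu < l%:R * I := lt_rate.
  by rewrite -subr_gt0 opprK.
have l2 : 0 < l%:R + 2 :> R by rewrite addr_gt0.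
have d0 : 0 < d by rewrite divr_gt0.
have dE : d * (l%:R + 2) = l%:R * I + mu by rewrite divfK // gt_eqF.
have dI : d <= I.
  rewrite -(ler_pM2l lr0); move: dE mu_le0 d0 => /=; lra.
pose pW (xy : X * Y) := q xy.1 * W xy.1 xy.2.
pose fC (xy : X * Y) := ln (W xy.1 xy.2) - ln (output_law q W xy.2).
have pWp : is_pmf pW.
  split=> [xy|]; first by rewrite mulr_ge0 //; case: (Wch xy.1).
  rewrite -(pair_bigA _ (fun x y => q x * W x y)) /= -q1.
  apply: eq_bigr => x _; rewrite -mulr_sumr.
  by case: (Wch x) => _ ->; rewrite mulr1.
have IE : I = \sum_xy pW xy * fC xy by exact: mi_chE.
pose vS := \sum_o iid p o * (fS o - mu) ^+ 2.
pose vC := \sum_xy pW xy * (fC xy - I) ^+ 2.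
have vS0 : 0 <= vS.
  by apply: sumr_ge0 => o _; rewrite mulr_ge0 ?sqr_ge0 // iid_ge0.
have vC0 : 0 <= vC.
  by apply: sumr_ge0 => o _; rewrite mulr_ge0 ?sqr_ge0 //; case: pWp.
pose K : R := #|S|%:R ^+ l.
have K0 : 0 <= K by rewrite exprn_ge0 // ler0n.
have S0 : (0 < #|S|)%N.
  case: (pickP (fun _ : O => true)) => [o _|no].
    by apply/card_gt0P; exists (tS o).
  by move: p1; rewrite big_pred0 // => /esym/eqP; rewrite oner_eq0.
(* Each of the three error terms is at most a constant over the number of blocks, and [c] adds these
   constants. The last uses [expR x >= 1 + x] for [beta]. *)
pose c := vS / d ^+ 2 + vC / d ^+ 2 + K * (2 / d).
have c0 : 0 <= c.
  rewrite /c; apply: addr_ge0; first by rewrite addr_ge0 // divr_ge0 // sqr_ge0.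
  by rewrite mulr_ge0 // divr_ge0 // ltW.
pose M := (Num.bound (c / eps)).+1.
have cM : c <= eps * M%:R.
  have := archi_boundP (divr_ge0 c0 (ltW eps0)).
  rewrite ltr_pdivrMr // => /ltW h; apply: le_trans h _.
  by rewrite mulrC ler_pM2l // ler_nat.
exists (l * M)%N => n leN v vE.
pose m := (n %/ l)%N.
have leMm : (M <= m)%N by rewrite /m leq_divRL // mulnC.
have m0 : (0 < m)%N by apply: leq_trans leMm.
have mr0 : 0 < m%:R :> R by rewrite ltr0n.
have lemn : (m <= n)%N by apply: leq_div.
have n0 : (0 < n)%N by apply: leq_trans lemn.
have nr0 : 0 < n%:R :> R by rewrite ltr0n.
have leml : m%:R * l%:R <= n%:R :> R by rewrite -natrM ler_nat leq_divM.
pose beta := expR (m%:R * d / 2).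
have beta0 : 0 < beta by exact: expR_gt0.
have g'0 (t : {ffun 'I_n -> S}) (w : {ffun 'I_n -> V}) :
  0 <= \prod_b g (blocks l t b) (blocks l w b).
  by apply: prodr_ge0 => b _; apply: ltW.
have [enc [dec le_err]] := one_shot (fun o : {ffun 'I_n -> O} => [ffun i => tS (o i)]) v
  (fun o => iid_ge0 o p0) (proj2 (is_pmf_iid _ pp)) (is_pmf_iid _ qp)
  (@is_channel_memoryless _ _ n _ Wch) g'0
  (fun w => sum_prod_blocks_le w l0 S0 (fun t v => ltW (g0 t v)) g1) beta0.
exists enc, dec; apply: le_trans le_err _.
pose badS (o : {ffun 'I_n -> O}) :=
  m%:R * d <= `|\sum_b fS (blocks l o b) - m%:R * mu|.
pose badC (s : {ffun 'I_n -> X * Y}) := n%:R * d <= `|\sum_i fC (s i) - n%:R * I|.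
have leS : \sum_o iid p o * (badS o)%:R <= vS / (d ^+ 2 * m%:R).
  have := @chebyshev_iid R 'I_m _ (iid p) fS mu d (is_pmf_iid _ pp) erefl d0.
  rewrite card_ord => /(_ m0); apply: le_trans.
  have := @sum_iid_blocks R 'I_n 'I_m 'I_l O p (@block_pos n l)
    (fun u => (m%:R * d <= `|\sum_b fS (u b) - m%:R * mu|)%R%:R) (@block_pos_inj n l) p1.
  by move=> <-.
have leC : \sum_s iid pW s * (badC s)%:R <= vC / (d ^+ 2 * n%:R).
  have := @chebyshev_iid R 'I_n _ pW fC I d pWp IE d0.
  by rewrite card_ord => /(_ n0).
(* For a typical source sequence the test fails only when the information density is atypical. *)
have split_err (o : {ffun 'I_n -> O}) : 0 < iid p o -> ~~ badS o ->
    \sum_(x : {ffun 'I_n -> X}) \sum_(y : {ffun 'I_n -> Y}) iid q x * memoryless W x y *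
      (\prod_b g (blocks l [ffun i => tS (o i)] b) (blocks l (v o) b) *
         memoryless W x y <= beta * output_law (iid q) (memoryless W) y)%R%:R
    <= \sum_s iid pW s * (badC s)%:R.
  move=> _ gS.
  rewrite (sum_memoryless_pair q W (fun s => (badC s)%:R)).
  apply: ler_sum => x _; apply: ler_sum => y _.
  have w0 : 0 <= iid q x * memoryless W x y.
    by rewrite mulr_ge0 ?iid_ge0 //; case: (@is_channel_memoryless _ _ n _ Wch x).
  have := w0; rewrite le_eqVlt => /orP[/eqP <-|wgt0]; first by rewrite !mul0r.
  apply: ler_wpM2l => //.
  case: (boolP (_ <= beta * _)%R) => [le_b|_]; last exact: ler0n.
  case: (boolP (badC _)) => //; rewrite /badC -ltNge ltr_norml => /andP[gC _].
  exfalso; move: le_b; apply/negP; rewrite -ltNge.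
  have pos i : 0 < q (x i) * W (x i) (y i).
    rewrite lt0r mulr_ge0 //; last by case: (Wch (x i)).
    rewrite andbT; apply: contraTneq wgt0 => e.
    rewrite /iid /memoryless -big_split /= (bigD1 i) //= e mul0r.
    by rewrite ltxx.
  have Wpos i : 0 < W (x i) (y i).
    rewrite lt0r; case: (Wch (x i)) => -> _; rewrite andbT.
    by apply: contraTneq (pos i) => ->; rewrite mulr0 ltxx.
  have Qpos i : 0 < output_law q W (y i) by apply: output_law_gt0 (pos i).
  rewrite output_law_memoryless /memoryless (prod_expR_ln Wpos) (prod_expR_ln Qpos).
  rewrite (prod_expR_ln (fun b => g0 _ _)) -!expRD ltr_expR.
  move: gS; rewrite /badS -ltNge ltr_norml => /andP[gS _].
  have eS : \sum_b fS (blocks l o b) = \sum_b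
     ln (g (blocks l [ffun i => tS (o i)] b) (blocks l (v o) b)).
    apply: eq_bigr => b _; rewrite /fS vE; congr (ln (g _ _)).
    by apply/ffunP => j; rewrite !ffunE.
  have eC : \sum_i fC ([ffun i => (x i, y i)] i) =
    \sum_i ln (W (x i) (y i)) - \sum_i ln (output_law q W (y i)).
    by rewrite -sumrB; apply: eq_bigr => i _; rewrite ffunE.
  rewrite eS in gS; rewrite eC in gC.
  set A := \sum_(b < _) _ in gS *.
  set B := \sum_i ln (W _ _) in gC *.
  set C := \sum_i ln (output_law _ _ _) in gC *.
  have key : m%:R * (l%:R * (I - d)) <= n%:R * (I - d).
    by rewrite mulrA ler_wpM2r // subr_ge0.
  have key2 : m%:R * (d * (l%:R + 2)) = m%:R * (l%:R * I + mu) by rewrite dE.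
  have md0 : 0 < m%:R * d by rewrite mulr_gt0.
  by lra.
apply: (@le_trans _ _ (vS / (d ^+ 2 * m%:R) + vC / (d ^+ 2 * n%:R) + K / beta)).
  rewrite lerD2r; apply: le_trans (lerD leS leC).
  set eC := (X in _ + X).
  have -> : eC = \sum_(o : {ffun 'I_n -> O}) iid p o * eC.
    by rewrite -mulr_suml (proj2 (is_pmf_iid 'I_n pp)) mul1r.
  rewrite -big_split; apply: ler_sum => o _ /=; rewrite -mulrDr.
  have := iid_ge0 o p0; rewrite le_eqVlt => /orP[/eqP <-|po]; first by rewrite !mul0r.
  apply: ler_wpM2l; first exact: ltW.
  have [bS|gS] := boolP (badS o); last by rewrite add0r; apply: split_err.
  apply: (@le_trans _ _ 1); last first.
    by rewrite lerDl sumr_ge0 // => s _; rewrite mulr_ge0 ?iid_ge0 //; case: pWp.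
  have tot : \sum_(x : {ffun 'I_n -> X}) \sum_y iid q x * memoryless W x y = 1.
    rewrite -(proj2 (is_pmf_iid 'I_n qp)); apply: eq_bigr => x _.
    by rewrite -mulr_sumr (proj2 (@is_channel_memoryless _ _ n _ Wch x)) mulr1.
  rewrite -[leRHS]tot; apply: ler_sum => x _; apply: ler_sum => y _.
  have w0 : 0 <= iid q x * memoryless W x y.
    by rewrite mulr_ge0 ?iid_ge0 //; case: (@is_channel_memoryless _ _ n _ Wch x).
  by rewrite -[leRHS]mulr1; apply: ler_wpM2l => //; rewrite lern1 leq_b1.
have le_m (x : R) : 0 <= x -> x / (d ^+ 2 * n%:R) <= x / (d ^+ 2 * m%:R).
  move=> x0; apply: ler_wpM2l => //.
  have dd : 0 < d ^+ 2 by rewrite exprn_gt0.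
  have dm : 0 < d ^+ 2 * m%:R by rewrite mulr_gt0.
  have dn : 0 < d ^+ 2 * n%:R by rewrite mulr_gt0.
  by rewrite lef_pV2 ?posrE // ler_pM2l // ler_nat.
have leK : K / beta <= K * (2 / d) / m%:R.
  rewrite -mulrA; apply: ler_wpM2l => //.
  rewrite -[leRHS]invrK lef_pV2 ?posrE ?invr_gt0 ?divr_gt0 //.
  have -> : (2 / d / m%:R)^-1 = m%:R * d / 2.
    by field; rewrite !gt_eqF.
  by apply: le_trans (expR_ge1Dx _); rewrite lerDr.
apply: (@le_trans _ _ (c / m%:R)).
  rewrite /c mulrDl [in leRHS]mulrDl; apply: lerD => //; apply: lerD.
    by rewrite invfM mulrA.
  by apply: le_trans (le_m _ vC0) _; rewrite invfM mulrA.
rewrite ler_pdivrMr //; apply: le_trans cM _.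
by rewrite ler_pM2l // ler_nat.
Qed.

End BlockCoding.

(** * A fixed-length code for the common output *)

(** Number the elements of [B] and use the residue modulo [#|V|] to choose the image: inside a fibre
    the quotients are distinct, and they are below [c]. *)
Lemma balanced_map (T V : finType) (B : {set T}) (c : nat) :
  (0 < #|V|)%N -> (#|B| <= c * #|V|)%N ->
  exists f : T -> V, forall v, (#|[set x in B | f x == v]| <= c)%N.
Proof.
move=> V0 leB; have [v0 _] := card_gt0P V0.
exists (fun x => nth v0 (enum V) (index x (enum B) %% #|V|)) => v.
set F := [set x in B | _].
pose h x := (index x (enum B) %/ #|V|)%N.
have F_B x : x \in F -> x \in B by rewrite inE => /andP[].
have F_v x : x \in F -> (index x (enum B) %% #|V|)%N = index v (enum V).
  rewrite inE => /andP[_ /eqP <-]; rewrite index_uniq ?enum_uniq // -cardE.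
  by rewrite ltn_mod.
rewrite cardE -(size_map h) -(size_iota 0 c); apply: uniq_leq_size.
  rewrite map_inj_in_uniq ?enum_uniq // => x y.
  rewrite !mem_enum /h => xF yF e.
  have ei : index x (enum B) = index y (enum B).
    by rewrite (divn_eq (index x _) #|V|) (divn_eq (index y _) #|V|) e !F_v.
  have inB z : z \in F -> z \in enum B by rewrite mem_enum; apply: F_B.
  by rewrite -(nth_index x (inB x xF)) ei nth_index // inB.
move=> n /mapP[x]; rewrite mem_enum => xF ->.
rewrite mem_iota /= add0n /h ltn_divLR //; apply: leq_trans leB.
by rewrite cardE index_mem mem_enum F_B.
Qed.

Section SourceCode.
Variables (R : realType) (S V : finType) (zero : pred S) (k l : nat).
Hypothesis zero1 : #|zero| = 1%N.
Hypothesis cardS : #|S| = (#|V| ^ k)%N.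
Hypothesis V2 : (2 <= #|V|)%N.
Hypothesis k4 : (4 <= k)%N.

Let theta : R := 2 / k%:R.
Let a := #|V|.

Definition pattern (s : {ffun 'I_l -> S}) : {ffun 'I_l -> bool} :=
  [ffun i => ~~ zero (s i)].

Definition weight (u : {ffun 'I_l -> bool}) : nat := \sum_i u i.

(* Bound on the fibres of the encoder over the words with zero-pattern [u]: the
   nonzero words need [k * weight u] letters and only [l] are sent. *)
Definition overflow (u : {ffun 'I_l -> bool}) : nat := (a ^ (k * weight u - l))%N.

Let theta_gt0 : 0 < theta.
Proof. by rewrite divr_gt0 // ltr0n (leq_trans _ k4). Qed.

Let theta_le : theta <= 1 / 2.
Proof.
have k4R : 4 <= k%:R :> R by rewrite ler_nat.
by rewrite /theta ler_pdivrMr ?(lt_le_trans _ k4R) //; lra.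
Qed.

(** The count factors over positions: a zero position admits a single word, any other at most
    [a ^ k]. *)
Lemma card_pattern (u : {ffun 'I_l -> bool}) :
  (#|[set s | pattern s == u]| <= a ^ (k * weight u))%N.
Proof.
rewrite -sum1dep_card big_mkcond /=.
under eq_bigr => s _.
  rewrite (_ : (if _ then _ else _) = \prod_i ((~~ zero (s i)) == u i : nat)); first over.
  case: eqP => [<-|ne]; first by rewrite big1 // => i _; rewrite ffunE eqxx.
  apply/esym/eqP; rewrite -leqn0 leqNgt; apply: contra_notN ne => pos.
  apply/ffunP => i; apply/eqP; rewrite ffunE.
  move: pos; rewrite (bigD1 i) //=; case: (_ == _) => //.
rewrite -(bigA_distr_bigA (fun i x => ((~~ zero x) == u i : nat))) /=.
apply: (@leq_trans (\prod_i (a ^ k) ^ u i)%N).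
  apply: leq_prod => i _; case: (u i); rewrite ?expn1 ?expn0.
    by rewrite /a -cardS -sum1_card; apply: leq_sum => x _; case: (~~ _).
  rewrite -zero1 -sum1_card [leqRHS]big_mkcond; apply: leq_sum => x _ /=.
  by rewrite unfold_in; case: (zero x).
by rewrite -expn_sum expnM.
Qed.

(** One balanced map per pattern, selected by the pattern of the input. Subtraction is truncated, so
    a pattern whose words fit in [l] letters has overflow one and no ambiguity. *)
Lemma exists_source_encoder : exists enc : {ffun 'I_l -> S} -> {ffun 'I_l -> V},
  forall u v, (#|[set s | (pattern s == u) && (enc s == v)]| <= overflow u)%N.
Proof.
have a0 : (0 < a)%N by apply: leq_trans V2.
have cV : #|{ffun 'I_l -> V}| = (a ^ l)%N by rewrite card_ffun card_ord.
have f_ex u : exists f : {ffun 'I_l -> S} -> {ffun 'I_l -> V},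
    forall v, (#|[set s in [set s | pattern s == u] | f s == v]| <= overflow u)%N.
  apply: balanced_map; first by rewrite cV expn_gt0 a0.
  apply: leq_trans (card_pattern u) _; rewrite cV -expnD.
  by rewrite leq_pexp2l // addnC -leq_subLR.
have [f fP] := choice f_ex.
exists (fun s => f (pattern s) s) => u v; apply: leq_trans (fP u v).
apply: subset_leq_card; apply/fintype.subsetP => s; rewrite !inE => /andP[/eqP e].
by rewrite e eqxx.
Qed.

Variable enc : {ffun 'I_l -> S} -> {ffun 'I_l -> V}.
Hypothesis encP : forall u v,
  (#|[set s | (pattern s == u) && (enc s == v)]| <= overflow u)%N.

Definition pattern_prior (b : bool) : R := if b then theta else 1 - theta.

(* Guess of the block given what the common output [v] shows: the first term is
   used when both encoders agree on the block, the uniform term when they differ. *)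
Definition predictor (s : {ffun 'I_l -> S}) (v : {ffun 'I_l -> V}) : R :=
  (iid pattern_prior (pattern s) / (overflow (pattern s))%:R * (enc s == v)%:R
   + ((a ^ (k * l))%:R)^-1) / 2.

Let prior_gt0 b : 0 < pattern_prior b.
Proof. by have := theta_le; have := theta_gt0; rewrite /pattern_prior; case: b; lra. Qed.

Let prior_le1 b : pattern_prior b <= 1.
Proof. by have := theta_le; have := theta_gt0; rewrite /pattern_prior; case: b; lra. Qed.

Let a_gt0 : (0 < a)%N. Proof. exact: leq_trans V2. Qed.

Let overflow_gt0 u : 0 < (overflow u)%:R :> R.
Proof. by rewrite ltr0n expn_gt0 a_gt0. Qed.

Let iid_prior_gt0 (u : {ffun 'I_l -> bool}) : 0 < iid pattern_prior u.
Proof. by apply: prodr_gt0. Qed.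

Let first_term_ge0 s v :
  0 <= iid pattern_prior (pattern s) / (overflow (pattern s))%:R * (enc s == v)%:R.
Proof. by rewrite mulr_ge0 ?ler0n //; apply: divr_ge0; apply: ltW. Qed.

Let second_term_gt0 : 0 < ((a ^ (k * l))%:R)^-1 :> R.
Proof. by rewrite invr_gt0 ltr0n expn_gt0 a_gt0. Qed.

Lemma predictor_gt0 s v : 0 < predictor s v.
Proof. by apply: divr_gt0 => //; apply: ltr_wpDl. Qed.

(** At most [overflow u] blocks of pattern [u] are compatible with [v], so the first term sums to at
    most the total prior mass. *)
Lemma sum_predictor v : \sum_s predictor s v <= 1.
Proof.
rewrite -mulr_suml ler_pdivrMr // mul1r big_split /= -[2]/(1 + 1).
apply: lerD; last first.
  rewrite sumr_const -[leLHS]mulr_natl (_ : #|_| = (a ^ (k * l))%N).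
    by rewrite divff // pnatr_eq0 -lt0n expn_gt0 a_gt0.
  by rewrite card_ffun card_ord cardS -expnM.
have prior_pmf : is_pmf pattern_prior.
  by split=> [b|]; [exact: ltW | rewrite big_bool /= addrC subrK].
rewrite -[leRHS](proj2 (is_pmf_iid 'I_l prior_pmf)) (partition_big pattern xpredT) //=.
apply: ler_sum => u _.
rewrite (eq_bigr (fun s => iid pattern_prior u / (overflow u)%:R * (enc s == v)%:R));
  last by move=> s /eqP ->.
rewrite -mulr_sumr -mulrA mulrC -[leRHS]mul1r; apply: ler_wpM2r; first exact: ltW.
rewrite mulrC ler_pdivrMr // mul1r -natr_sum ler_nat.
apply: leq_trans (encP u v); rewrite -sum1dep_card big_mkcondr /=.
by apply: leq_sum => s _; case: (_ == _).
Qed.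

Let cost (b : bool) : R := - ln (pattern_prior b).

(** The four costs are the mixture, the positions, the overflow and a failure. On failure [s'] is
    arbitrary, which later allows the overflow to be measured on the second source for both
    receivers. *)
Lemma neg_ln_predictor_le (s s' : {ffun 'I_l -> S}) (v : {ffun 'I_l -> V}) (fail : bool) :
  (~~ fail -> enc s = v /\ s' = s) ->
  - ln (predictor s v) <= ln 2 + \sum_i cost (~~ zero (s i))
     + (k * weight (pattern s') - l)%:R * ln a%:R + fail%:R * ((k * l)%:R * ln a%:R).
Proof.
move=> ok.
have cost0 b : 0 <= cost b by rewrite oppr_ge0 ln_le0.
have lna0 : 0 <= ln a%:R :> R by rewrite ln_ge0 // ler1n.
have sum0 : 0 <= \sum_i cost (~~ zero (s i)) by apply: sumr_ge0.
case: fail ok => [_|/(_ isT) [<- ->]]; rewrite ?mul1r ?mul0r ?addr0.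
  have le_g : ((a ^ (k * l))%:R)^-1 / 2 <= predictor s v.
    by rewrite /predictor ler_pM2r ?invr_gt0 // lerDr.
  have ln_g : ln (((a ^ (k * l))%:R)^-1 / 2) <= ln (predictor s v).
    by rewrite ler_ln // posrE ?predictor_gt0 // divr_gt0.
  move: ln_g; rewrite ln_div ?posrE // lnV ?posrE ?ltr0n ?expn_gt0 ?a_gt0 //.
  rewrite natrX lnXn ?ltr0n // -[ln a%:R *+ _]mulr_natl.
  have : 0 <= (k * weight (pattern s') - l)%:R * ln a%:R :> R by rewrite mulr_ge0.
  by lra.
have le_g : iid pattern_prior (pattern s) / (overflow (pattern s))%:R / 2
    <= predictor s (enc s).
  by rewrite /predictor ler_pM2r ?invr_gt0 // eqxx mulr1 lerDl ltW.
have qpos : 0 < iid pattern_prior (pattern s) / (overflow (pattern s))%:R.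
  exact: divr_gt0.
have ln_g : ln (iid pattern_prior (pattern s) / (overflow (pattern s))%:R / 2)
    <= ln (predictor s (enc s)).
  by rewrite ler_ln // posrE ?predictor_gt0 // divr_gt0.
move: ln_g; rewrite ln_div ?posrE // ln_div ?posrE //.
rewrite {1}/overflow natrX lnXn ?ltr0n // -[ln a%:R *+ _]mulr_natl.
have -> : \sum_i cost (~~ zero (s i)) = - ln (iid pattern_prior (pattern s)).
  rewrite /iid prod_expR_ln // expRK -sumrN.
  by apply: eq_bigr => i _; rewrite ffunE.
by lra.
Qed.

End SourceCode.

(** Comes from [(y - 2 c) ^ 2 >= 0]; it bounds the truncated excess by a quantity whose mean is a
    variance. *)
Lemma natr_subn_le (R : realType) (m l : nat) (c : R) : 0 < c ->
  (m - l)%:R <= (m%:R - l%:R) ^+ 2 / (4 * c) + c.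
Proof.
move=> c0; have c40 : 0 < 4 * c by rewrite mulr_gt0.
have [lt_ml|le_lm] := ltnP m l.
  have -> : (m - l)%N = 0%N by apply/eqP; apply: ltnW.
  apply: addr_ge0; last exact: ltW.
  by apply: divr_ge0; [exact: sqr_ge0 | exact: ltW].
rewrite natrB //; set y : R := _ - _.
rewrite -lerBlDr ler_pdivlMr //.
have := sqr_ge0 (y - 2 * c); rewrite !expr2; lra.
Qed.

(** * Expected cost of the guess over one block *)

Section BlockCost.
Variables (R : realType) (S V : finType) (zero : pred S) (k : nat).
Hypothesis V2 : (2 <= #|V|)%N.
Hypothesis k4 : (4 <= k)%N.
Let l := (k ^ 3)%N.
Variable enc : {ffun 'I_l -> S} -> {ffun 'I_l -> V}.
Variables (p : S * S -> R) (proj : S * S -> S).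
Variable vb : {ffun 'I_l -> S * S} -> {ffun 'I_l -> V}.
Hypothesis p_pmf : is_pmf p.
Hypothesis proj_diag : forall s, proj (s, s) = s.
Hypothesis nz2 : \sum_o p o * (~~ zero o.2)%:R = k%:R^-1.
Hypothesis nz_proj : \sum_o p o * (~~ zero (proj o))%:R <= 2 / k%:R.
Hypothesis differ : \sum_o p o * (o.1 != o.2)%:R * k%:R ^+ 7 <= 1.
Hypothesis vb_diag : forall o : {ffun 'I_l -> S * S},
  (forall i, (o i).1 = (o i).2) -> vb o = enc [ffun i => proj (o i)].

Lemma hbE : hb (2 / k%:R : R) =
  2 / k%:R * ln (k%:R / 2) - (1 - 2 / k%:R) * ln (1 - 2 / k%:R).
Proof.
have k4R : 4 <= k%:R :> R by rewrite ler_nat.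
have k0 : 0 < k%:R :> R by lra.
have t0 : 0 < 2 / k%:R :> R by rewrite divr_gt0.
have t1 : 2 / k%:R <= 1 / 2 :> R by rewrite ler_pdivrMr //; lra.
rewrite /hb /plogp !gt_eqF //; last by lra.
have -> : k%:R / 2 = (2 / k%:R)^-1 :> R by rewrite invf_div.
by rewrite lnV ?posrE // mulrN.
Qed.

(* With [l = k ^ 3] the fluctuation of the number of nonzero words, of order
   [sqrt (l / k) = k] words or [k ^ 2] letters, is negligible against [2 l / k]. *)
Lemma block_cost_lt :
  - (\sum_o iid p o * ln (predictor R zero k enc [ffun j => proj (o j)] (vb o)))
  < l%:R * (hb (2 / k%:R) + 2 / k%:R * ln #|V|%:R).
Proof.
have [p0 p1] := p_pmf.
have k4R : 4 <= k%:R :> R by rewrite ler_nat.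
have k0 : 0 < k%:R :> R by lra.
have lE : l%:R = k%:R ^+ 3 :> R by rewrite natrX.
have t0 : 0 < 2 / k%:R :> R by rewrite divr_gt0.
have t1 : 2 / k%:R <= 1 / 2 :> R by rewrite ler_pdivrMr //; lra.
pose La : R := ln #|V|%:R.
have La0 : 0 < La by rewrite ln_gt0 // ltr1n.
have ln2La : ln 2 <= La by rewrite ler_ln ?posrE ?ltr0n ?ler_nat // (leq_trans _ V2).
pose cost b := - ln (pattern_prior R k b).
pose f1 (x : S * S) := cost (~~ zero (proj x)).
(* The [f2 (o i)] add up to the excess [k * weight - l]. The second source is used because its
   frequency of nonzero words is exactly [1/k], which centres the sum. *)
pose f2 (x : S * S) := k%:R * (~~ zero x.2)%:R - 1 : R.
pose f3 (x : S * S) := (x.1 != x.2)%:R : R.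
have f2mean : \sum_x p x * f2 x = 0.
  under eq_bigr do rewrite mulrBr mulr1 mulrCA.
  by rewrite sumrB -mulr_sumr nz2 p1 divff ?subrr // gt_eqF.
have f2var : \sum_x p x * f2 x ^+ 2 = k%:R - 1.
  rewrite (eq_bigr (fun x => (k%:R ^+ 2 - k%:R * 2) * (p x * (~~ zero x.2)%:R) + p x)).
    rewrite big_split /= -mulr_sumr nz2 p1; field; exact: lt0r_neq0.
  by move=> x _; rewrite /f2; case: (~~ _); rewrite /= ?mulr1 ?mulr0; ring.
have pointwise (o : {ffun 'I_l -> S * S}) :
  - ln (predictor R zero k enc [ffun j => proj (o j)] (vb o)) <=
  ln 2 + \sum_i f1 (o i)
    + La * ((\sum_i f2 (o i)) ^+ 2 / (4 * k%:R ^+ 2) + k%:R ^+ 2)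
    + (\sum_i f3 (o i)) * ((k * l)%:R * La).
  pose fail := [exists i, (o i).1 != (o i).2].
  have := @neg_ln_predictor_le R S V zero k l V2 k4 enc
    [ffun j => proj (o j)] [ffun j => (o j).2] (vb o) fail.
  have diag : ~~ fail -> enc [ffun j => proj (o j)] = vb o /\
      [ffun j => (o j).2] = [ffun j => proj (o j)].
    move/existsPn => nf; have eq12 i : (o i).1 = (o i).2.
      by have := nf i; rewrite negbK => /eqP.
    split; first by rewrite vb_diag.
    apply/ffunP => i; rewrite !ffunE.
    have := eq12 i; case: (o i) => x y /= ->.
    by rewrite proj_diag.
  move=> /(_ diag) h; apply: le_trans h _.
  apply: lerD; last first.
    apply: ler_wpM2r; first by rewrite mulr_ge0 ?ler0n // ltW.
    rewrite /fail; case: existsP => [[i ni]|_]; last by rewrite sumr_ge0.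
    by rewrite (bigD1 i) //= /f3 ni lerDl sumr_ge0.
  apply: lerD.
    rewrite lerD2l le_eqVlt; apply/orP; left; apply/eqP.
    by apply: eq_bigr => i _; rewrite ffunE.
  rewrite mulrC ler_wpM2l ?(ltW La0) //.
  (* The free constant is [k ^ 2], the order of the standard deviation [sqrt (l * (k - 1))] of the
     excess. *)
  have k20 : 0 < k%:R ^+ 2 :> R by rewrite exprn_gt0.
  apply: le_trans (natr_subn_le (k * weight (pattern zero [ffun j => (o j).2])) l k20) _.
  rewrite lerD2r ler_wpM2r ?invr_ge0 ?mulr_ge0 ?(ltW k20) //.
  suff -> : (k * weight (pattern zero [ffun j => (o j).2]))%:R - l%:R = \sum_i f2 (o i) by [].
  rewrite /f2 sumrB sumr_const card_ord -mulr_sumr natrM natr_sum.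
  congr (_ * _ - _); apply: eq_bigr => i _.
  by rewrite !ffunE.
have iidp0 (o : {ffun 'I_l -> S * S}) : 0 <= iid p o by apply: iid_ge0.
have tot : \sum_(o : {ffun 'I_l -> S * S}) iid p o = 1 := proj2 (is_pmf_iid _ p_pmf).
rewrite -sumrN.
apply: (@le_lt_trans _ _ (\sum_(o : {ffun 'I_l -> S * S}) iid p o * (ln 2 + \sum_i f1 (o i)
    + La * ((\sum_i f2 (o i)) ^+ 2 / (4 * k%:R ^+ 2) + k%:R ^+ 2)
    + (\sum_i f3 (o i)) * ((k * l)%:R * La)))).
  by apply: ler_sum => o _; rewrite -mulrN ler_wpM2l.
have -> : \sum_(o : {ffun 'I_l -> S * S}) iid p o * (ln 2 + \sum_i f1 (o i)
    + La * ((\sum_i f2 (o i)) ^+ 2 / (4 * k%:R ^+ 2) + k%:R ^+ 2)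
    + (\sum_i f3 (o i)) * ((k * l)%:R * La))
  = ln 2 + l%:R * (\sum_x p x * f1 x)
    + La * (l%:R * (k%:R - 1) / (4 * k%:R ^+ 2) + k%:R ^+ 2)
    + l%:R * (\sum_x p x * f3 x) * ((k * l)%:R * La).
  have e1 := @sum_iid_sum R 'I_l _ p f1 p1.
  have e2 := sum_iid_sqr 'I_l p1 f2mean.
  have e3 := @sum_iid_sum R 'I_l _ p f3 p1.
  rewrite card_ord in e1 e2 e3; rewrite -e1 -e3 -f2var -e2.
  rewrite (eq_bigr (fun o => iid p o * (ln 2 + La * k%:R ^+ 2) + iid p o * (\sum_i f1 (o i))
    + iid p o * (\sum_i f2 (o i)) ^+ 2 * (La / (4 * k%:R ^+ 2))
    + iid p o * (\sum_i f3 (o i)) * ((k * l)%:R * La))); last by move=> o _; ring.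
  by rewrite !big_split /= -!mulr_suml tot; ring.
pose P := \sum_o p o * (~~ zero (proj o))%:R.
(* The cost of positions is affine in the frequency [P], with slope [ln (k / 2 - 1)], nonnegative
   for [k >= 4]; so it is largest at [P = 2 / k], where it equals [hb (2 / k)]. *)
have f1mean : \sum_x p x * f1 x <= hb (2 / k%:R).
  have -> : \sum_x p x * f1 x =
     P * ln (k%:R / 2) - (1 - P) * ln (1 - 2 / k%:R).
    have -> : ln (k%:R / 2) = - ln (2 / k%:R) :> R.
      by rewrite -lnV ?posrE // invf_div.
    rewrite (eq_bigr (fun x => p x * (~~ zero (proj x))%:R *
        (ln (1 - 2 / k%:R) - ln (2 / k%:R)) + p x * - ln (1 - 2 / k%:R))).
      by rewrite big_split /= -!mulr_suml p1 -/P; ring.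
    by move=> x _; rewrite /f1 /cost /pattern_prior; case: (~~ _) => /=; ring.
  rewrite hbE -subr_ge0.
  have -> : 2 / k%:R * ln (k%:R / 2) - (1 - 2 / k%:R) * ln (1 - 2 / k%:R)
    - (P * ln (k%:R / 2) - (1 - P) * ln (1 - 2 / k%:R))
    = (2 / k%:R - P) * (ln (k%:R / 2) + ln (1 - 2 / k%:R)) by ring.
  rewrite mulr_ge0 ?subr_ge0 //.
  rewrite -lnM ?posrE ?divr_gt0 //; last by lra.
  rewrite ln_ge0 //.
  have -> : k%:R / 2 * (1 - 2 / k%:R) = k%:R / 2 - 1 :> R by field; exact: lt0r_neq0.
  by lra.
(* Origin of the exponent 7: [l] positions may differ and each failure costs [k * l] letters, with
   [l = k ^ 3]. Failures thus cost at most one letter on average. *)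
have f3mean : l%:R * (\sum_x p x * f3 x) * ((k * l)%:R * La) <= La.
  rewrite natrM lE; move: differ; rewrite -mulr_suml /f3 => d.
  set D := \sum_x _ in d *.
  have -> : k%:R ^+ 3 * D * (k%:R * k%:R ^+ 3 * La) = (D * k%:R ^+ 7) * La by ring.
  by rewrite -[leRHS]mul1r ler_wpM2r // ltW.
have l0 : 0 <= l%:R :> R by rewrite ler0n.
have midle : l%:R * (k%:R - 1) / (4 * k%:R ^+ 2) + k%:R ^+ 2 <= 5 / 4 * k%:R ^+ 2 :> R.
  rewrite lE.
  have -> : k%:R ^+ 3 * (k%:R - 1) / (4 * k%:R ^+ 2) = (k%:R ^+ 2 - k%:R) / 4 :> R.
    by field; exact: lt0r_neq0.
  by lra.
have := ler_wpM2l l0 f1mean.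
have := ler_wpM2l (ltW La0) midle.
(* Budget: [2 / k] letters per position make [2 k ^ 2] letters per block. Overflow takes at most
   [5/4 k ^ 2], the mixture and the failures at most one each. *)
have : La * 2 < La * (3 / 4 * k%:R ^+ 2).
  rewrite ltr_pM2l //.
  have : 4 * 4 <= k%:R * k%:R :> R by rewrite ler_pM //; lra.
  by rewrite expr2; lra.
have -> : l%:R * (hb (2 / k%:R) + 2 / k%:R * ln #|V|%:R)
   = l%:R * hb (2 / k%:R) + La * (2 * k%:R ^+ 2) :> R.
  by rewrite lE -/La; field; exact: lt0r_neq0.
have -> : La * (3 / 4 * k%:R ^+ 2) = 3 / 4 * (La * k%:R ^+ 2) by ring.
have -> : La * (5 / 4 * k%:R ^+ 2) = 5 / 4 * (La * k%:R ^+ 2) by ring.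
have -> : La * (2 * k%:R ^+ 2) = 2 * (La * k%:R ^+ 2) by ring.
by lra.
Qed.

End BlockCost.

(** * Transmissibility *)

Section SourceFamily.
Variables (R : realType) (a k eta : nat).
Hypothesis a2 : (2 <= a)%N.
Hypothesis k2 : (2 <= k)%N.
Local Notation word := {ffun 'I_k -> 'I_a}.

Definition letter0 : 'I_a := Ordinal (leq_trans (isT : (0 < 2)%N) a2).
Definition word0 : word := [ffun=> letter0].

Lemma is_zero_wordE (c : word) : is_zero_word c = (c == word0).
Proof.
apply/forallP/eqP => [h|-> i]; last by rewrite ffunE.
by apply/ffunP => i; apply/val_inj; rewrite ffunE; apply/eqP/h.
Qed.

Definition agree_mass : R :=
  ((a%:R : R) ^+ (eta * k) - 1)
    / (k%:R * (a%:R : R) ^+ (eta * k) * ((a%:R : R) ^+ k - 1)).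
Definition differ_mass : R :=
  1 / (k%:R * (a%:R : R) ^+ (eta * k) * ((a%:R : R) ^+ k - 1)).

(** The support has three parts: both words zero, equal nonzero words, and a zero first word with a
    nonzero second one. *)
Lemma sum_src (F : word * word -> R) :
  \sum_o src_fam R eta o.1 o.2 * F o =
  (k%:R - 1) / k%:R * F (word0, word0)
  + agree_mass * (\sum_(c | c != word0) F (c, c))
  + differ_mass * (\sum_(d | d != word0) F (word0, d)).
Proof.
rewrite (eq_bigr (fun o => src_fam R eta o.1 o.2 * F (o.1, o.2))); last by case.
rewrite -(pair_bigA _ (fun c d : word => src_fam R eta c d * F (c, d))) /=.
rewrite (bigD1 word0) //= (bigD1 word0) //=.
rewrite {1}/src_fam !is_zero_wordE eqxx /= -!addrA; congr (_ + _).
rewrite addrC !mulr_sumr; congr (_ + _); apply: eq_bigr => c c0.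
  rewrite (bigD1 c) //= [X in _ + X]big1 ?addr0.
    by rewrite /src_fam !is_zero_wordE (negPf c0) eqxx.
  by move=> d dc; rewrite /src_fam !is_zero_wordE (negPf c0) [c == d]eq_sym (negPf dc) /= mul0r.
by rewrite /src_fam !is_zero_wordE (negPf c0) eqxx /= eq_sym (negPf c0).
Qed.

Let k_gt0 : 0 < k%:R :> R. Proof. by rewrite ltr0n ltnW. Qed.

Let A_ge1 : 1 <= (a%:R : R) ^+ (eta * k).
Proof. by rewrite exprn_ege1 // ler1n ltnW. Qed.

Let A_gt0 : 0 < (a%:R : R) ^+ (eta * k).
Proof. exact: lt_le_trans A_ge1. Qed.

Lemma nonzero_words_gt0 : 0 < (a%:R : R) ^+ k - 1.
Proof. by rewrite subr_gt0 exprn_egt1 ?ltr1n // -lt0n ltnW. Qed.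

Lemma card_nonzero_words (x : R) :
  \sum_(c : word | c != word0) x = ((a%:R : R) ^+ k - 1) * x.
Proof.
rewrite sumr_const cardC1 card_ffun !card_ord -[LHS]mulr_natl; congr (_ * _).
by rewrite -subn1 natrB ?natrX // expn_gt0 ltnW.
Qed.

Let den_neq0 : [/\ (k%:R : R) != 0, (a%:R : R) ^+ (eta * k) != 0
  & (a%:R : R) ^+ k - 1 != 0].
Proof. by split; apply: lt0r_neq0 => //; exact: nonzero_words_gt0. Qed.

Lemma agree_mass_total :
  agree_mass * ((a%:R : R) ^+ k - 1) = (1 - 1 / (a%:R : R) ^+ (eta * k)) / k%:R.
Proof.
have [k0 A0 n0] := den_neq0; rewrite /agree_mass.
move: (_ ^+ (eta * k)) (_ ^+ k - 1) A0 n0 => A n A0 n0.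
by field; rewrite k0 A0 n0.
Qed.

Lemma differ_mass_total :
  differ_mass * ((a%:R : R) ^+ k - 1) = 1 / (a%:R : R) ^+ (eta * k) / k%:R.
Proof.
have [k0 A0 n0] := den_neq0; rewrite /differ_mass.
move: (_ ^+ (eta * k)) (_ ^+ k - 1) A0 n0 => A n A0 n0.
by field; rewrite k0 A0 n0.
Qed.

Lemma agree_mass_ge0 : 0 <= agree_mass.
Proof.
rewrite divr_ge0 ?subr_ge0 //; apply: ltW.
by rewrite mulr_gt0 ?nonzero_words_gt0 // mulr_gt0.
Qed.

Lemma differ_mass_ge0 : 0 <= differ_mass.
Proof.
rewrite divr_ge0 ?ler01 //; apply: ltW.
by rewrite mulr_gt0 ?nonzero_words_gt0 // mulr_gt0.
Qed.

Lemma src_ge0 (c d : word) : 0 <= src_fam R eta c d.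
Proof.
rewrite /src_fam; case: ifP => _.
  by rewrite divr_ge0 ?(ltW k_gt0) // subr_ge0 ler1n ltnW.
case: ifP => _; first exact: agree_mass_ge0.
by case: ifP => _ //; exact: differ_mass_ge0.
Qed.

Lemma src_pmf : is_pmf (fun o : word * word => src_fam R eta o.1 o.2).
Proof.
split=> [o|]; first exact: src_ge0.
have := sum_src (fun=> 1); under eq_bigr do rewrite mulr1.
move=> ->; rewrite !card_nonzero_words !mulr1 agree_mass_total differ_mass_total.
have [k0 A0 n0] := den_neq0.
by field; rewrite k0 A0.
Qed.

Lemma src_snd_nonzero :
  \sum_o src_fam R eta o.1 o.2 * (~~ is_zero_word (o.2 : word))%:R = k%:R^-1.
Proof.
rewrite sum_src /= !is_zero_wordE eqxx mulr0 add0r.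
have one : \sum_(c : word | c != word0) (~~ is_zero_word c)%:R = (a%:R : R) ^+ k - 1.
  rewrite -[RHS]mulr1 -card_nonzero_words; apply: eq_bigr => c c0.
  by rewrite is_zero_wordE c0.
rewrite one agree_mass_total differ_mass_total.
have [k0 A0 n0] := den_neq0.
by field; rewrite k0 A0.
Qed.

Lemma src_fst_nonzero :
  \sum_o src_fam R eta o.1 o.2 * (~~ is_zero_word (o.1 : word))%:R <= k%:R^-1.
Proof.
rewrite sum_src /= !is_zero_wordE eqxx mulr0 add0r.
rewrite [X in _ + _ * X]big1_eq mulr0 addr0.
have one : \sum_(c : word | c != word0) (~~ is_zero_word c)%:R = (a%:R : R) ^+ k - 1.
  rewrite -[RHS]mulr1 -card_nonzero_words; apply: eq_bigr => c c0.
  by rewrite is_zero_wordE c0.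
rewrite one agree_mass_total -[leRHS]mul1r ler_wpM2r ?invr_ge0 ?(ltW k_gt0) //.
by rewrite lerBlDr lerDl divr_ge0 // ltW.
Qed.

Lemma src_differ :
  \sum_o src_fam R eta o.1 o.2 * ((o.1 : word) != o.2)%:R
  = 1 / (a%:R : R) ^+ (eta * k) / k%:R.
Proof.
rewrite sum_src /= eqxx mulr0 add0r.
rewrite big1 => [|c _]; last by rewrite eqxx.
rewrite mulr0 add0r (eq_bigr (fun=> 1)).
  by rewrite card_nonzero_words mulr1 differ_mass_total.
by move=> c c0; rewrite eq_sym c0.
Qed.

(** The sources differ with mass [1 / (k A)], so the claim is [k ^ 6 <= A]. It follows from
    [k < 2 ^ k] and [eta >= 6]. *)
Lemma src_differ_small : (6 <= eta)%N ->
  \sum_o src_fam R eta o.1 o.2 * ((o.1 : word) != o.2)%:R * k%:R ^+ 7 <= 1.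
Proof.
move=> eta6; rewrite -mulr_suml src_differ.
have le_kA : k%:R ^+ 6 <= (a%:R : R) ^+ (eta * k).
  rewrite -!natrX ler_nat; apply: (@leq_trans ((2 ^ k) ^ 6)).
    by rewrite leq_exp2r // ltnW // ltn_expl.
  rewrite -expnM mulnC; apply: (@leq_trans (a ^ (6 * k))).
    by rewrite leq_exp2r // muln_gt0 /= ltnW.
  by rewrite leq_pexp2l ?(ltnW a2) // leq_mul2r eta6 orbT.
have -> : 1 / (a%:R : R) ^+ (eta * k) / k%:R * k%:R ^+ 7
   = k%:R ^+ 6 / (a%:R : R) ^+ (eta * k).
  have [k0 A0 n0] := den_neq0.
  move: (_ ^+ (eta * k)) A0 => A A0.
  by field; rewrite k0 A0.
by rewrite ler_pdivrMr // mul1r.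
Qed.

End SourceFamily.

Lemma hb_ge0 (R : realType) (x : R) : 0 <= x <= 1 -> 0 <= hb x.
Proof.
have plogp_le0 (y : R) : 0 <= y <= 1 -> plogp y <= 0.
  move=> /andP[y0 y1]; rewrite /plogp; case: eqP => // _.
  by rewrite mulr_ge0_le0 // ln_le0.
move=> /andP[x0 x1]; rewrite /hb -opprD oppr_ge0.
rewrite -oppr_ge0 opprD addr_ge0 // oppr_ge0 plogp_le0 ?x0 ?x1 //.
by rewrite subr_ge0 x1 lerBlDr lerDl x0.
Qed.

(** * Coding for both receivers over the interference channel *)

Section Transmission.
Variable R : realType.

(** Positions outside every block receive the filler [v0]. *)
Lemma exists_blockwise (S V : finType) (v0 : V) (n l : nat)
    (enc : {ffun 'I_l -> S} -> {ffun 'I_l -> V}) :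
  exists f : {ffun 'I_n -> S} -> {ffun 'I_n -> V},
    forall s b, blocks l (f s) b = enc (blocks l s b).
Proof.
exists (fun s => [ffun i =>
  if [pick bj : 'I_(n %/ l) * 'I_l | block_pos bj.1 bj.2 == i] is Some bj
  then enc (blocks l s bj.1) bj.2 else v0]) => s b.
apply/ffunP => j; rewrite !ffunE; case: pickP => [[b' j'] /= /eqP e|/(_ (b, j))/=].
  by case: (block_pos_inj e) => -> ->; rewrite /blocks ffunE.
by rewrite eqxx.
Qed.

Definition common_output (a : nat) (y0 z1 z2 : 'I_a) : 'I_a :=
  if z1 == z2 then z1 else y0.

Lemma W0E (a : nat) (y0 z1 z2 y : 'I_a) : val y0 = 0%N ->
  W0 R z1 z2 y = (y == common_output y0 z1 z2)%:R.
Proof.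
move=> y00; rewrite /W0 /common_output; case: (z1 == z2).
  by case: (y == z1).
rewrite -[y == y0](inj_eq val_inj) y00.
by case: (val y == 0%N).
Qed.

(** Summing out the other receiver leaves a deterministic common letter and one satellite channel,
    so each receiver can be analysed alone. *)
Lemma sum_ic_snd (a : nat) (y0 : 'I_a) (X1 Y1 X2 Y2 : finType)
    (Ws1 : X1 -> Y1 -> R) (Ws2 : X2 -> Y2 -> R) (u1 : 'I_a * X1) (u2 : 'I_a * X2)
    (v1 : 'I_a * Y1) : val y0 = 0%N -> is_channel Ws2 ->
  \sum_v2 ic_fam a Ws1 Ws2 u1 u2 v1 v2
  = (v1.1 == common_output y0 u1.1 u2.1)%:R * Ws1 u1.2 v1.2.
Proof.
move=> y00 Wch.
rewrite -(pair_bigA _ (fun c y => ic_fam a Ws1 Ws2 u1 u2 v1 (c, y))) /=.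
rewrite (bigD1 v1.1) //= [X in _ + X]big1 ?addr0.
  rewrite /ic_fam /= eqxx -mulr_sumr (proj2 (Wch u2.2)) mulr1 mul1r.
  by rewrite (W0E _ _ _ y00).
move=> c nc; apply: big1 => y _; rewrite /ic_fam /= eq_sym (negPf nc).
by rewrite !mul0r.
Qed.

Lemma sum_ic_fst (a : nat) (y0 : 'I_a) (X1 Y1 X2 Y2 : finType)
    (Ws1 : X1 -> Y1 -> R) (Ws2 : X2 -> Y2 -> R) (u1 : 'I_a * X1) (u2 : 'I_a * X2)
    (v2 : 'I_a * Y2) : val y0 = 0%N -> is_channel Ws1 ->
  \sum_v1 ic_fam a Ws1 Ws2 u1 u2 v1 v2
  = (v2.1 == common_output y0 u1.1 u2.1)%:R * Ws2 u2.2 v2.2.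
Proof.
move=> y00 Wch.
rewrite -(pair_bigA _ (fun c y => ic_fam a Ws1 Ws2 u1 u2 (c, y) v2)) /=.
rewrite (bigD1 v2.1) //= [X in _ + X]big1 ?addr0.
  rewrite /ic_fam /= eqxx -mulr_suml -mulr_sumr (proj2 (Wch u1.2)) mulr1 mul1r.
  by rewrite (W0E _ _ _ y00).
move=> c nc; apply: big1 => y _; rewrite /ic_fam /= (negPf nc).
by rewrite !mul0r.
Qed.

(** A deterministic first output turns into side information, and the remaining channel is the
    memoryless satellite. *)
Lemma sum_known_fst (V X Y : finType) (n : nat) (W : X -> Y -> R)
    (c : {ffun 'I_n -> V}) (x : {ffun 'I_n -> X}) (F : {ffun 'I_n -> V * Y} -> R) :
  \sum_(y : {ffun 'I_n -> V * Y})
    (\prod_i (((y i).1 == c i)%:R * W (x i) (y i).2)) * F y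
  = \sum_y memoryless W x y * F [ffun i => (c i, y i)].
Proof.
pose G (v : {ffun 'I_n -> V}) (y : {ffun 'I_n -> Y}) :=
  (\prod_i ((v i == c i)%:R * W (x i) (y i))) * F [ffun i => (v i, y i)].
transitivity (\sum_v \sum_y G v y).
  rewrite -(sum_ffun_pair G); apply: eq_bigr => y _; rewrite /G; congr (_ * F _).
    by apply: eq_bigr => i _; rewrite !ffunE.
  by apply/ffunP => i; rewrite !ffunE -surjective_pairing.
rewrite (bigD1 c) //= [X in _ + X]big1 ?addr0.
  apply: eq_bigr => y _; rewrite /G; congr (_ * _).
  by apply: eq_bigr => i _; rewrite eqxx mul1r.
move=> v nv; apply: big1 => y _; rewrite /G.
have [i ni] : exists i, v i != c i.
  apply/existsP; rewrite -negb_forall; apply: contraNN nv => /forallP h.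
  by apply/eqP/ffunP => i; apply/eqP.
by rewrite (bigD1 i) //= (negPf ni) !mul0r.
Qed.

Lemma transmissible_ic (a k eta : nat) (X1 Y1 X2 Y2 : finType)
    (Ws1 : X1 -> Y1 -> R) (Ws2 : X2 -> Y2 -> R) :
  (6 <= eta)%N -> (2 <= a)%N -> (4 <= k)%N -> is_channel Ws1 -> is_channel Ws2 ->
  is_capacity Ws1 (C_I R a k) ->
  is_capacity Ws2 (C_I R a k + hb (2 / (k%:R * (a%:R : R) ^+ (eta * k)))) ->
  transmissible (@src_fam R a k eta) (ic_fam a Ws1 Ws2).
Proof.
move=> eta6 a2 k4 W1ch W2ch [_ cap1] [_ cap2] eps eps0.
have k2 : (2 <= k)%N by apply: leq_trans k4.
have kR : 4 <= k%:R :> R by rewrite ler_nat.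
have k0 : 0 < k%:R :> R by lra.
pose S := {ffun 'I_k -> 'I_a}.
pose zero : pred S := @is_zero_word a k.
have zero1 : #|zero| = 1%N.
  rewrite -(card1 (word0 k a2)); apply: eq_card => c.
  by rewrite -[LHS]/(is_zero_word c) (is_zero_wordE a2).
have cardS : #|S| = (#|'I_a| ^ k)%N by rewrite card_ffun !card_ord.
have V2 : (2 <= #|'I_a|)%N by rewrite card_ord.
pose l := (k ^ 3)%N.
have l0 : (0 < l)%N by rewrite expn_gt0 ltnW.
have lR : 0 < l%:R :> R by rewrite ltr0n.
have [enc encP] := @exists_source_encoder S 'I_a zero k l zero1 cardS V2.
pose y0 := letter0 a2.
pose join (c d : {ffun 'I_l -> 'I_a}) : {ffun 'I_l -> 'I_a} :=
  [ffun j => common_output y0 (c j) (d j)].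
pose vb (o : {ffun 'I_l -> S * S}) :=
  join (enc [ffun j => (o j).1]) (enc [ffun j => (o j).2]).
pose p (o : S * S) : R := src_fam R eta o.1 o.2.
have pp : is_pmf p := src_pmf R eta a2 k2.
have nz2 : \sum_o p o * (~~ zero o.2)%:R = k%:R^-1 := src_snd_nonzero R eta a2 k2.
have diff : \sum_o p o * (o.1 != o.2)%:R * k%:R ^+ 7 <= 1 := src_differ_small R a2 k2 eta6.
have le_inv : k%:R^-1 <= 2 / k%:R :> R by rewrite ler_pMl ?invr_gt0 // ler1n.
have vb_diag (proj : S * S -> S) : (forall s, proj (s, s) = s) ->
    forall o : {ffun 'I_l -> S * S},
    (forall i, (o i).1 = (o i).2) -> vb o = enc [ffun i => proj (o i)].
  move=> pd o oe.
  have e1 : [ffun j => (o j).1] = [ffun i => proj (o i)].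
    by apply/ffunP => i; rewrite !ffunE; have := oe i; case: (o i) => x y /= ->; rewrite pd.
  have e2 : [ffun j => (o j).2] = [ffun i => proj (o i)].
    by apply/ffunP => i; rewrite !ffunE; have := oe i; case: (o i) => x y /= ->; rewrite pd.
  by rewrite /vb e1 e2; apply/ffunP => j; rewrite ffunE /common_output eqxx.
have CI_E : l%:R * C_I R a k = l%:R * (hb (2 / k%:R) + 2 / k%:R * ln #|'I_a|%:R).
  by rewrite card_ord.
(* Stated once for both receivers: [proj] is [fst] or [snd]. *)
have code (proj : S * S -> S) (X Y : finType) (W : X -> Y -> R) (C : R) :
    (forall s, proj (s, s) = s) -> is_channel W -> C_I R a k <= C ->
    (forall e, 0 < e -> exists q, is_pmf q /\ C - e < mi_ch q W) ->
    \sum_o p o * (~~ zero (proj o))%:R <= 2 / k%:R ->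
    exists N, forall n, (N <= n)%N ->
    forall v : {ffun 'I_n -> S * S} -> {ffun 'I_n -> 'I_a},
    (forall o b, blocks l (v o) b = vb (blocks l o b)) ->
    exists (f : {ffun 'I_n -> S} -> {ffun 'I_n -> X})
           (dec : {ffun 'I_n -> 'I_a} -> {ffun 'I_n -> Y} -> {ffun 'I_n -> S}),
    \sum_o iid p o * \sum_y memoryless W (f [ffun i => proj (o i)]) y *
      (dec (v o) y != [ffun i => proj (o i)])%:R <= eps / 2.
  move=> pd Wch leC cap nzp.
  have := block_cost_lt V2 k4 pp pd nz2 nzp diff (vb_diag proj pd).
  set cost := - _ => lt_cost.
  (* Capacity is only a supremum; an input law is taken within the slack between [C_I] and the cost
     per letter. *)
  have e0 : 0 < C_I R a k - cost / l%:R.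
    by rewrite subr_gt0 ltr_pdivrMr // mulrC CI_E.
  have [q [qp lt_mi]] := cap _ e0.
  have lt_rate : cost < l%:R * mi_ch q W.
    rewrite mulrC -ltr_pdivrMr //; lra.
  apply: (block_coding l0 pp qp Wch _ _ lt_rate); last by rewrite divr_gt0.
    by move=> t v; apply: predictor_gt0.
  by move=> v; apply: sum_predictor.
have hb0 : 0 <= hb (2 / (k%:R * (a%:R : R) ^+ (eta * k))).
  have A1 : 1 <= (a%:R : R) ^+ (eta * k) by rewrite exprn_ege1 // ler1n ltnW.
  have kA : 4 * 1 <= k%:R * (a%:R : R) ^+ (eta * k) by rewrite ler_pM.
  have kA0 : 0 < k%:R * (a%:R : R) ^+ (eta * k) by lra.
  by apply: hb_ge0; rewrite divr_ge0 ?(ltW kA0) //= ler_pdivrMr // mul1r; lra.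
have [N1 code1] := code fst X1 Y1 Ws1 _ (fun=> erefl) W1ch (lexx _) cap1
  (le_trans (src_fst_nonzero R eta a2 k2) le_inv).
have le2 : C_I R a k <= C_I R a k + hb (2 / (k%:R * (a%:R : R) ^+ (eta * k))).
  by rewrite lerDl.
have nz2' : \sum_o p o * (~~ zero o.2)%:R <= 2 / k%:R by rewrite nz2.
have [N2 code2] := code snd X2 Y2 Ws2 _ (fun=> erefl) W2ch le2 cap2 nz2'.
exists (maxn N1 N2) => n; rewrite geq_max => /andP[n1 n2].
have [z zE] := @exists_blockwise S 'I_a y0 n l enc.
pose v (o : {ffun 'I_n -> S * S}) : {ffun 'I_n -> 'I_a} :=
  [ffun i => common_output y0 (z [ffun i => (o i).1] i) (z [ffun i => (o i).2] i)].
have vE o b : blocks l (v o) b = vb (blocks l o b).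
  have z1E := zE [ffun i => (o i).1] b; have z2E := zE [ffun i => (o i).2] b.
  have b1 : blocks l [ffun i => (o i).1] b = [ffun j => (blocks l o b j).1].
    by apply/ffunP => j; rewrite !ffunE.
  have b2 : blocks l [ffun i => (o i).2] b = [ffun j => (blocks l o b j).2].
    by apply/ffunP => j; rewrite !ffunE.
  rewrite /vb -b1 -b2 -z1E -z2E; apply/ffunP => j.
  by rewrite !ffunE.
have [f1 [dec1 err1]] := code1 n n1 v vE.
have [f2 [dec2 err2]] := code2 n n2 v vE.
exists (fun s => [ffun i => (z s i, f1 s i)]), (fun s => [ffun i => (z s i, f2 s i)]),
  (fun y => dec1 [ffun i => (y i).1] [ffun i => (y i).2]),
  (fun y => dec2 [ffun i => (y i).1] [ffun i => (y i).2]).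
(* Union bound over the two receivers. *)
apply: le_trans (_ : eps / 2 + eps / 2 <= _); last by rewrite -splitr.
apply: le_trans (lerD err1 err2).
pose E1 (s1 s2 : {ffun 'I_n -> S}) := (\prod_i src_fam R eta (s1 i) (s2 i)) *
  \sum_y memoryless Ws1 (f1 s1) y *
    (dec1 [ffun i => common_output y0 (z s1 i) (z s2 i)] y != s1)%:R.
pose E2 (s1 s2 : {ffun 'I_n -> S}) := (\prod_i src_fam R eta (s1 i) (s2 i)) *
  \sum_y memoryless Ws2 (f2 s2) y *
    (dec2 [ffun i => common_output y0 (z s1 i) (z s2 i)] y != s2)%:R.
have iidE (o : {ffun 'I_n -> S * S}) : iid p o =
    \prod_i src_fam R eta ([ffun i => (o i).1] i) ([ffun i => (o i).2] i).
  by apply: eq_bigr => i _; rewrite !ffunE.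
have -> : \sum_o iid p o * \sum_y memoryless Ws1 (f1 [ffun i => (o i).1]) y *
      (dec1 (v o) y != [ffun i => (o i).1])%:R = \sum_s1 \sum_s2 E1 s1 s2.
  by rewrite -(sum_ffun_pair E1); apply: eq_bigr => o _; rewrite iidE.
have -> : \sum_o iid p o * \sum_y memoryless Ws2 (f2 [ffun i => (o i).2]) y *
      (dec2 (v o) y != [ffun i => (o i).2])%:R = \sum_s1 \sum_s2 E2 s1 s2.
  by rewrite -(sum_ffun_pair E2); apply: eq_bigr => o _; rewrite iidE.
rewrite -big_split; apply: ler_sum => s1 _ /=.
rewrite -big_split; apply: ler_sum => s2 _ /=.
rewrite /E1 /E2 -mulrDr; apply: ler_wpM2l.
  by apply: prodr_ge0 => i _; apply: src_ge0.
set c := [ffun i => common_output y0 (z s1 i) (z s2 i)].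
set u1 := [ffun i => (z s1 i, f1 s1 i)]; set u2 := [ffun i => (z s2 i, f2 s2 i)].
pose d1 (y : {ffun 'I_n -> 'I_a * Y1}) := dec1 [ffun i => (y i).1] [ffun i => (y i).2].
pose d2 (y : {ffun 'I_n -> 'I_a * Y2}) := dec2 [ffun i => (y i).1] [ffun i => (y i).2].
pose ic (y1 : {ffun 'I_n -> 'I_a * Y1}) (y2 : {ffun 'I_n -> 'I_a * Y2}) : R := \prod_(i < n) ic_fam a Ws1 Ws2 (u1 i) (u2 i) (y1 i) (y2 i).
have ic0 (y1 : {ffun 'I_n -> 'I_a * Y1}) (y2 : {ffun 'I_n -> 'I_a * Y2}) : 0 <= ic y1 y2.
  apply: prodr_ge0 => i _; rewrite /ic_fam (W0E _ _ _ (erefl : val y0 = 0%N)).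
  apply: mulr_ge0; last by case: (W2ch (u2 i).2).
  apply: mulr_ge0; last by case: (W1ch (u1 i).2).
  by apply: mulr_ge0; [case: (_ == _) | exact: ler0n].
apply: (@le_trans _ _ (\sum_y1 \sum_y2 ic y1 y2 * (d1 y1 != s1)%:R +
                       \sum_y1 \sum_y2 ic y1 y2 * (d2 y2 != s2)%:R)).
  rewrite -big_split; apply: ler_sum => y1 _ /=.
  rewrite -big_split; apply: ler_sum => y2 _ /=.
  rewrite -mulrDr; apply: ler_wpM2l; first exact: ic0.
  by rewrite /d1 /d2; case: (_ != _); case: (_ != _); rewrite /= ?addr0 ?add0r // lerDl.
apply: lerD.
  have -> : \sum_y1 \sum_y2 ic y1 y2 * (d1 y1 != s1)%:R =
    \sum_(y1 : {ffun 'I_n -> 'I_a * Y1}) (\prod_i (((y1 i).1 == c i)%:R * Ws1 (f1 s1 i) (y1 i).2)) * (d1 y1 != s1)%:R.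
    apply: eq_bigr => y1 _; rewrite -mulr_suml; congr (_ * _).
    rewrite /ic -(bigA_distr_bigA (fun i v2 => ic_fam a Ws1 Ws2 (u1 i) (u2 i) (y1 i) v2)).
    apply: eq_bigr => i _; rewrite (sum_ic_snd _ _ _ _ (erefl : val y0 = 0%N)) //.
    by rewrite !ffunE.
  rewrite sum_known_fst; apply: ler_sum => y _; rewrite /d1.
  rewrite (_ : [ffun i => _.1] = c); last by apply/ffunP => i; rewrite !ffunE.
  by rewrite (_ : [ffun i => _.2] = y) //; apply/ffunP => i; rewrite !ffunE.
rewrite exchange_big /=.
have -> : \sum_y2 \sum_y1 ic y1 y2 * (d2 y2 != s2)%:R =
  \sum_(y2 : {ffun 'I_n -> 'I_a * Y2}) (\prod_i (((y2 i).1 == c i)%:R * Ws2 (f2 s2 i) (y2 i).2)) * (d2 y2 != s2)%:R.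
  apply: eq_bigr => y2 _; rewrite -mulr_suml; congr (_ * _).
  rewrite /ic -(bigA_distr_bigA (fun i v1 => ic_fam a Ws1 Ws2 (u1 i) (u2 i) v1 (y2 i))).
  apply: eq_bigr => i _; rewrite (sum_ic_fst _ _ _ _ (erefl : val y0 = 0%N)) //.
  by rewrite !ffunE.
rewrite sum_known_fst; apply: ler_sum => y _; rewrite /d2.
rewrite (_ : [ffun i => _.1] = c); last by apply/ffunP => i; rewrite !ffunE.
by rewrite (_ : [ffun i => _.2] = y) //; apply/ffunP => i; rewrite !ffunE.
Qed.

End Transmission.

(** * The first Liu-Chen condition fails *)

Section Converse.
Variable R : realType.

Lemma law_ge (O T : finType) (P : O -> R) (X : O -> T) (o : O) :
  (forall o, 0 <= P o) -> P o <= law P X (X o).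
Proof.
by move=> P0; rewrite /law (bigD1 o) //= lerDl sumr_ge0.
Qed.

(* Gibbs' inequality: any conditional sub-distribution [r] bounds H(Y|Z). *)
Lemma cmi_le_cross (O T U V : finType) (P : O -> R) (X : O -> T) (Y : O -> U)
    (Z : O -> V) (r : U -> V -> R) (phi : O -> R) :
  (forall o, 0 <= P o) -> \sum_o P o = 1 -> (forall y z, 0 <= r y z) ->
  (forall z, \sum_y r y z <= 1) ->
  (forall o, 0 < P o -> 0 < r (Y o) (Z o) /\ - ln (r (Y o) (Z o)) <= phi o) ->
  cmi P X Y Z <= \sum_o P o * phi o.
Proof.
move=> P0 P1 r0 r1 rphi.
rewrite /cmi !entE -subr_ge0 !opprK.
(* Ratio of the guess to the true conditional probability; its mean is at most one, so adding
   [rat o - 1] only lowers the sum, and [ln x <= x - 1] then makes every term nonnegative. *)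
pose rat o := r (Y o) (Z o) * law P Z (Z o) / law P (fun o => (Y o, Z o)) (Y o, Z o).
have rat_le : \sum_o P o * rat o <= 1.
  rewrite (partition_big (fun o => (Y o, Z o)) xpredT) //=.
  apply: (@le_trans _ _ (\sum_(yz : U * V) r yz.1 yz.2 * law P Z yz.2)).
    apply: ler_sum => -[y z] _ /=.
    rewrite (eq_bigr (fun o => P o * (r y z * law P Z z / law P (fun o => (Y o, Z o)) (y, z)))); last first.
      by move=> o /eqP[e1 e2]; rewrite /rat e1 e2.
    rewrite -mulr_suml.
    have lz : 0 <= law P Z z by apply: sumr_ge0.
    have [l0|l0] := eqVneq (law P (fun o => (Y o, Z o)) (y, z)) 0.
      by rewrite l0 invr0 mulr0 mulr0 mulr_ge0.
    rewrite -[\sum_(o | _) P o]/(law P (fun o => (Y o, Z o)) (y, z)).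
    by rewrite mulrCA divff // mulr1.
  rewrite -(pair_bigA _ (fun y z => r y z * law P Z z)) /= exchange_big /=.
  apply: (@le_trans _ _ (\sum_z law P Z z)).
    apply: ler_sum => z _; rewrite -mulr_suml -[leRHS]mul1r.
    by apply: ler_wpM2r => //; apply: sumr_ge0.
  rewrite -P1 [leRHS](partition_big Z xpredT) //=.
suff : 0 <= \sum_o P o * (phi o + ln (law P (fun o => (X o, Z o)) (X o, Z o))
    + ln (law P (fun o => (Y o, Z o)) (Y o, Z o))
    - ln (law P (fun o => (X o, Y o, Z o)) (X o, Y o, Z o))
    - ln (law P Z (Z o)) + (rat o - 1)).
  move=> h; apply: le_trans h _.
  rewrite (eq_bigr (fun o => P o * phi o + P o * ln (law P (fun o => (X o, Z o)) (X o, Z o))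
    + P o * ln (law P (fun o => (Y o, Z o)) (Y o, Z o))
    - P o * ln (law P (fun o => (X o, Y o, Z o)) (X o, Y o, Z o))
    - P o * ln (law P Z (Z o)) + (P o * rat o - P o))); last by move=> o _; ring.
  rewrite !big_split /= !sumrN P1; move: rat_le; lra.
apply: sumr_ge0 => o _.
have := P0 o; rewrite le_eqVlt => /orP[/eqP <-|Po]; first by rewrite mul0r.
apply: mulr_ge0 => //.
have [rpos rle] := rphi o Po.
have pos (W : finType) (K : O -> W) : 0 < law P K (K o).
  exact: lt_le_trans Po (law_ge K o P0).
have pYZ := pos _ (fun o => (Y o, Z o)); have pZ := pos _ Z.
have rat_pos : 0 < rat o by rewrite divr_gt0 // mulr_gt0.
have := @le_ln1Dx R (rat o - 1); rewrite addrCA subrr addr0.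
have -> : -1 < rat o - 1 by rewrite -subr_gt0 opprK subrK.
move=> /(_ isT); rewrite {1}/rat ln_div ?posrE ?mulr_gt0 // lnM ?posrE //.
(* Pointwise form of [H(Y|X,Z) >= 0], which lets that entropy be dropped. *)
have le_XYZ : ln (law P (fun o => (X o, Y o, Z o)) (X o, Y o, Z o)) <=
    ln (law P (fun o => (X o, Z o)) (X o, Z o)).
  rewrite ler_ln ?posrE ?(pos _ (fun o => (X o, Y o, Z o))) ?(pos _ (fun o => (X o, Z o))) //.
  rewrite !lawE; apply: ler_sum => o' _; apply: ler_wpM2l => //.
  by rewrite ler_nat !xpair_eqE; case: (_ == _); case: (_ == _).
by lra.
Qed.

Lemma neg_mul_ln_le1 (x : R) : 0 <= x -> - (x * ln x) <= 1.
Proof.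
rewrite le_eqVlt => /orP[/eqP <-|x0]; first by rewrite mul0r oppr0 ler01.
rewrite -mulrN -lnV ?posrE //.
have := ln_sublinear (_ : 0 < x^-1); rewrite invr_gt0 => /(_ x0) /ltW h.
by apply: le_trans (ler_wpM2l (ltW x0) h) _; rewrite divff // gt_eqF.
Qed.

End Converse.

(** * The two sides of the first condition for arbitrary auxiliary variables *)

Section LiuChenFails.
Variables (R : realType) (a k eta : nat).
Hypothesis a2 : (2 <= a)%N.
Hypothesis k2 : (2 <= k)%N.
Local Notation word := {ffun 'I_k -> 'I_a}.
Variables (X1 Y1 X2 Y2 : finType) (Ws1 : X1 -> Y1 -> R) (Ws2 : X2 -> Y2 -> R).
Hypothesis W1ch : is_channel Ws1.
Hypothesis W2ch : is_channel Ws2.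
Variables (Q W1 W2 : finType) (pQ : Q -> R) (pW1 : Q -> W1 -> R) (pW2 : Q -> W2 -> R).
Variables (pX1 : Q -> W1 -> word -> 'I_a * X1 -> R) (pX2 : Q -> W2 -> word -> 'I_a * X2 -> R).
Hypothesis pQp : is_pmf pQ.
Hypothesis pW1p : forall q, is_pmf (pW1 q).
Hypothesis pW2p : forall q, is_pmf (pW2 q).
Hypothesis pX1p : forall q w s, is_pmf (pX1 q w s).
Hypothesis pX2p : forall q w s, is_pmf (pX2 q w s).

Local Notation outcome :=
  (word * word * Q * W1 * W2 * ('I_a * X1) * ('I_a * X2) * ('I_a * Y1) * ('I_a * Y2))%type.
Let ic := ic_fam a Ws1 Ws2.
Let P := LC_joint (src_fam R eta) pQ pW1 pW2 pX1 pX2 ic.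
Let y0 := letter0 a2.
Let w0 := word0 k a2.

Lemma sum_outcome (F : outcome -> R) :
  \sum_o F o = \sum_s1 \sum_s2 \sum_q \sum_w1 \sum_w2 \sum_x1 \sum_x2 \sum_y1 \sum_y2
    F (s1, s2, q, w1, w2, x1, x2, y1, y2).
Proof.
rewrite !pair_bigA /=; apply: eq_bigr.
by do 8 case.
Qed.

Let ic_ge0 x1 x2 y1 y2 : 0 <= ic x1 x2 y1 y2.
Proof.
rewrite /ic /ic_fam (W0E R _ _ _ (erefl : val y0 = 0%N)).
apply: mulr_ge0; last by case: (W2ch x2.2).
apply: mulr_ge0; last by case: (W1ch x1.2).
by apply: mulr_ge0; [case: (_ == _) | exact: ler0n].
Qed.

Lemma LC_joint_ge0 o : 0 <= P o.
Proof.
move: o => [[[[[[[[s1 s2] q] w1] w2] x1] x2] y1] y2] /=.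
have [q0 _] := pQp; have [w10 _] := pW1p q; have [w20 _] := pW2p q.
have [x10 _] := pX1p q w1 s1; have [x20 _] := pX2p q w2 s2.
have s0 := src_ge0 R eta a2 k2 s1 s2; have i0 := ic_ge0 x1 x2 y1 y2.
by do 6 apply: mulr_ge0 => //.
Qed.

Lemma sum_y2_LC_joint s1 s2 q w1 w2 x1 x2 y1 :
  \sum_y2' P (s1, s2, q, w1, w2, x1, x2, y1, y2') =
  src_fam R eta s1 s2 * pQ q * pW1 q w1 * pW2 q w2 * pX1 q w1 s1 x1 * pX2 q w2 s2 x2
  * ((y1.1 == common_output y0 x1.1 x2.1)%:R * Ws1 x1.2 y1.2).
Proof. by rewrite -mulr_sumr (sum_ic_snd _ _ _ _ (erefl : val y0 = 0%N)). Qed.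

Lemma sum_y1 (x1 : 'I_a * X1) (x2 : 'I_a * X2) (F : 'I_a -> R) :
  \sum_(y1 : 'I_a * Y1) (y1.1 == common_output y0 x1.1 x2.1)%:R * Ws1 x1.2 y1.2 * F y1.1
  = F (common_output y0 x1.1 x2.1).
Proof.
rewrite -(pair_bigA _ (fun c y => (c == common_output y0 x1.1 x2.1)%:R * Ws1 x1.2 y * F c)) /=.
rewrite (bigD1 (common_output y0 x1.1 x2.1)) //= [X in _ + X]big1 ?addr0.
  by rewrite eqxx -mulr_suml -mulr_sumr (proj2 (W1ch x1.2)) !mul1r.
by move=> c nc; apply: big1 => y _; rewrite (negPf nc) !mul0r.
Qed.

(** The integrand sees only the common letter of the outputs, so the satellite outputs sum out and
    the rest is iterated in the order of the factorization. *)
Lemma sum_LC_joint (F : word -> word -> Q -> W1 -> W2 -> 'I_a -> R) :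
  \sum_o P o * (let '(s1, s2, q, w1, w2, _, _, y1, _) := o in F s1 s2 q w1 w2 y1.1) =
  \sum_s1 \sum_s2 src_fam R eta s1 s2 * \sum_q pQ q * \sum_w1 pW1 q w1 * \sum_w2 pW2 q w2 *
    \sum_x1 pX1 q w1 s1 x1 * \sum_x2 pX2 q w2 s2 x2 *
      F s1 s2 q w1 w2 (common_output y0 x1.1 x2.1).
Proof.
rewrite sum_outcome; apply: eq_bigr => s1 _; apply: eq_bigr => s2 _.
rewrite mulr_sumr; apply: eq_bigr => q _; rewrite 2!mulr_sumr; apply: eq_bigr => w1 _.
rewrite 3!mulr_sumr; apply: eq_bigr => w2 _; rewrite 4!mulr_sumr; apply: eq_bigr => x1 _.
rewrite 5!mulr_sumr; apply: eq_bigr => x2 _.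
rewrite -(sum_y1 x1 x2 (F s1 s2 q w1 w2)) 6!mulr_sumr; apply: eq_bigr => y1 _.
by rewrite -mulr_suml sum_y2_LC_joint; ring.
Qed.

Let pmf_const (T : finType) (p : T -> R) (x : R) : is_pmf p -> \sum_t p t * x = x.
Proof. by move=> [_ p1]; rewrite -mulr_suml p1 mul1r. Qed.

Lemma sum_LC_joint_src (F : word -> word -> R) :
  \sum_o P o * (let '(s1, s2, _, _, _, _, _, _, _) := o in F s1 s2) =
  \sum_o src_fam R eta o.1 o.2 * F o.1 o.2.
Proof.
rewrite -(pair_bigA _ (fun s1 s2 => src_fam R eta s1 s2 * F s1 s2)) /=.
rewrite (sum_LC_joint (fun s1 s2 _ _ _ _ => F s1 s2)).
apply: eq_bigr => s1 _; apply: eq_bigr => s2 _; congr (_ * _).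
rewrite -[RHS](pmf_const _ pQp); apply: eq_bigr => q _; congr (_ * _).
rewrite -[RHS](pmf_const _ (pW1p q)); apply: eq_bigr => w1 _; congr (_ * _).
rewrite -[RHS](pmf_const _ (pW2p q)); apply: eq_bigr => w2 _; congr (_ * _).
rewrite -[RHS](pmf_const _ (pX1p q w1 s1)); apply: eq_bigr => x1 _; congr (_ * _).
by rewrite -[RHS](pmf_const _ (pX2p q w2 s2)).
Qed.

Lemma sum_LC_joint1 : \sum_o P o = 1.
Proof.
have := sum_LC_joint_src (fun _ _ => 1).
under [RHS]eq_bigr do rewrite mulr1.
rewrite (proj2 (src_pmf R eta a2 k2)) => <-; apply: eq_bigr.
by do 8 case; move=> *; rewrite mulr1.
Qed.

Lemma sum_pmf_le (T : finType) (p f : T -> R) (x : R) :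
  is_pmf p -> (forall t, f t <= x) -> \sum_t p t * f t <= x.
Proof.
move=> pp fx; rewrite -[leRHS](pmf_const _ pp).
by apply: ler_sum => t _; apply: ler_wpM2l => //; case: pp.
Qed.

(** Law of [z_2] given [(Q, W_2)] when the second source vanishes. It depends only on conditioning
    variables, so a guess may use it. *)
Definition zero_input_law (q : Q) (w2 : W2) (y : 'I_a) : R :=
  \sum_x2 pX2 q w2 w0 x2 * (x2.1 == y)%:R.

Lemma zero_input_law_ge0 q w2 y : 0 <= zero_input_law q w2 y.
Proof. by apply: sumr_ge0 => x2 _; rewrite mulr_ge0 //; case: (pX2p q w2 w0). Qed.

Lemma sum_zero_input_law q w2 : \sum_y zero_input_law q w2 y = 1.
Proof.
rewrite exchange_big /= -[RHS](proj2 (pX2p q w2 w0)); apply: eq_bigr => x2 _.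
rewrite -mulr_sumr (bigD1 x2.1) //= eqxx big1 ?addr0 ?mulr1 //.
by move=> y ny; rewrite eq_sym (negPf ny).
Qed.

(** Equal mixture of three laws for the common letter (uniform, the default letter,
    [zero_input_law]), times the uniform law on [Y1]. *)
Let guess (y : 'I_a * Y1) (z : Q * W2) : R :=
  (a%:R^-1 + (y.1 == y0)%:R + zero_input_law z.1 z.2 y.1) / (3 * #|Y1|%:R).

(* When the sources vanish, the inputs are conditionally independent, so the
   mass that [y0] puts outside the default letter is a product of two laws. *)
Let collision (o : outcome) : R :=
  let '(s1, s2, q, w1, w2, _, _, y1, _) := o in
  (s2 == w0)%:R * (y1.1 != y0)%:R * - ln (zero_input_law q w2 y1.1).

Let nonzero (o : outcome) : R :=
  let '(s1, s2, q, w1, w2, _, _, y1, _) := o in (s2 != w0)%:R.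

(** Fix [x1]: a letter other than the default appears only if [z_2] hits [z_1], of probability [b]
    under [zero_input_law]. The contribution is at most [- b ln b]. *)
Lemma collision_le1 : \sum_o P o * collision o <= 1.
Proof.
rewrite (sum_LC_joint (fun s1 s2 q w1 w2 c =>
  (s2 == w0)%:R * (c != y0)%:R * - ln (zero_input_law q w2 c))).
rewrite (pair_bigA _ (fun s1 s2 => src_fam R eta s1 s2 * _)) /=.
apply: (sum_pmf_le (src_pmf R eta a2 k2)) => -[s1 s2] /=.
apply: (sum_pmf_le pQp) => q; apply: (sum_pmf_le (pW1p q)) => w1.
apply: (sum_pmf_le (pW2p q)) => w2; apply: (sum_pmf_le (pX1p q w1 s1)) => x1.
have [->|_] := eqVneq s2 w0; last first.
  by rewrite big1 ?ler01 // => x2 _; rewrite !mul0r mulr0.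
have b0 := zero_input_law_ge0 q w2 x1.1.
have b1 : zero_input_law q w2 x1.1 <= 1.
  rewrite -(sum_zero_input_law q w2) (bigD1 x1.1) //= lerDl sumr_ge0 // => y _.
  exact: zero_input_law_ge0.
apply: le_trans (neg_mul_ln_le1 b0).
rewrite -mulrN {2}/zero_input_law mulr_suml; apply: ler_sum => x2 _.
have p0 : 0 <= pX2 q w2 w0 x2 by case: (pX2p q w2 w0).
have l0 : 0 <= - ln (zero_input_law q w2 x1.1) by rewrite oppr_ge0 ln_le0.
rewrite -[leRHS]mulrA; apply: ler_wpM2l => //; rewrite mul1r /common_output [x2.1 == _]eq_sym.
case: (x1.1 == x2.1); last by rewrite eqxx !mul0r.
by rewrite mul1r; case: (_ != _); rewrite ?mul1r ?mul0r.
Qed.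

(** Each case uses one component of the mixture: uniform if the second word is nonzero, the point
    mass for the default letter, [zero_input_law] otherwise. *)
Lemma guess_bound (o : outcome) : 0 < P o ->
  let '(s1, s2, q, w1, w2, _, _, y1, _) := o in
  0 < guess y1 (q, w2) /\
  - ln (guess y1 (q, w2)) <= ln (3 * #|Y1|%:R) + nonzero o * ln a%:R + collision o.
Proof.
case: o => [[[[[[[[s1 s2] q] w1] w2] x1] x2] y1] y2] Po.
have Y1gt0 : 0 < 3 * #|Y1|%:R :> R.
  by rewrite mulr_gt0 // ltr0n; apply/card_gt0P; exists y1.2.
have a0 : 0 < a%:R :> R by rewrite ltr0n ltnW.
have ia0 : 0 < a%:R^-1 :> R by rewrite invr_gt0.
have lna0 : 0 <= ln a%:R :> R by rewrite ln_ge0 // ler1n ltnW.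
have b0 := zero_input_law_ge0 q w2 y1.1.
set t := a%:R^-1 + (y1.1 == y0)%:R + zero_input_law q w2 y1.1.
have t_gt0 : 0 < t by rewrite ltr_pwDl // ltr_pwDl.
split; first exact: divr_gt0.
rewrite /guess /= -/t ln_div ?posrE // opprB -addrA lerD2l.
have le_t (x : R) : 0 < x -> x <= t -> - ln t <= - ln x.
  by move=> x0 xt; rewrite lerN2 ler_ln ?posrE.
have [s20|s2n] := eqVneq s2 w0; last first.
  rewrite /= !mul0r addr0 mul1r; have := le_t _ ia0.
  rewrite lnV ?posrE // opprK; apply.
  by rewrite /t -addrA lerDl addr_ge0.
rewrite /= mul0r add0r mul1r.
have [y10|y1n] /= := eqVneq y1.1 y0.
  rewrite mul0r; have := le_t 1 ltr01; rewrite ln1 oppr0; apply.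
  by rewrite /t y10 eqxx -addrA addrCA lerDl addr_ge0 ?zero_input_law_ge0 // ltW.
rewrite mul1r; have := le_t (zero_input_law q w2 y1.1); apply; last first.
  by rewrite /t lerDr addr_ge0 // ltW.
have nz : P (s1, s2, q, w1, w2, x1, x2, y1, y2) != 0 by rewrite gt_eqF.
have y1E : y1.1 = common_output y0 x1.1 x2.1.
  apply/eqP; apply: contraNT nz => /negPf ne.
  by rewrite /P /= /ic /ic_fam (W0E R _ _ _ (erefl : val y0 = 0%N)) ne !(mulr0, mul0r).
(* A letter other than the default can only come from agreeing inputs, so [zero_input_law] charges
   it. *)
have x2E : x2.1 = y1.1.
  by move: y1n; rewrite y1E /common_output; case: (eqVneq x1.1 x2.1) => [->|_] //; rewrite eqxx.
have [p0 _] := pX2p q w2 w0.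
rewrite /zero_input_law (bigD1 x2) //= x2E eqxx mulr1 ltr_pwDl //; last first.
  by apply: sumr_ge0 => x _; rewrite mulr_ge0.
rewrite lt0r p0 andbT; apply: contraNneq nz => e.
by rewrite /P /= s20 e mulr0 mul0r.
Qed.

(** The variables are spelled as in [LiuChen], so that the first condition applies by conversion. *)
Lemma cmi_receiver1_le :
  cmi P
    (fun o : outcome => (let '(s1, _, _, _, _, _, _, _, _) := o in s1,
                         let '(_, _, _, _, _, x1, _, _, _) := o in x1))
    (fun o : outcome => let '(_, _, _, _, _, _, _, y1, _) := o in y1)
    (fun o : outcome => (let '(_, _, q, _, _, _, _, _, _) := o in q,
                         let '(_, _, _, _, w2, _, _, _, _) := o in w2))
  <= ln (3 * #|Y1|%:R) + ln a%:R / k%:R + 1.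
Proof.
pose phi o := ln (3 * #|Y1|%:R) + nonzero o * ln a%:R + collision o.
apply: (@le_trans _ _ (\sum_o P o * phi o)).
  apply: (@cmi_le_cross R _ _ _ _ P _ _ _ guess phi).
        exact: LC_joint_ge0.
       exact: sum_LC_joint1.
      move=> y z; apply: divr_ge0; last by rewrite mulr_ge0.
      by rewrite addr_ge0 ?zero_input_law_ge0 // addr_ge0 // invr_ge0.
    move=> [q w2]; rewrite /guess /=.
    rewrite -(pair_bigA _ (fun (c : 'I_a) (y : Y1) =>
      (a%:R^-1 + (c == y0)%:R + zero_input_law q w2 c) / (3 * #|Y1|%:R))) /=.
    have sum3 : \sum_(c : 'I_a) (a%:R^-1 + (c == y0)%:R + zero_input_law q w2 c) = 3.
      rewrite !big_split /= sum_zero_input_law sumr_const card_ord -[_ *+ a]mulr_natl divff.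
        rewrite (bigD1 y0) //= ?eqxx big1 ?addr0; last by move=> c /negPf ->.
        by ring.
      by rewrite pnatr_eq0 -lt0n ltnW.
    rewrite exchange_big /= (eq_bigr (fun=> 3 / (3 * #|Y1|%:R))).
      rewrite sumr_const -[leLHS]mulr_natl (_ : #|_| = #|Y1|) //.
      have [->|n0] := eqVneq (#|Y1|%:R : R) 0; first by rewrite mul0r ler01.
      by rewrite le_eqVlt; apply/orP; left; apply/eqP; field.
    by move=> y _; rewrite -mulr_suml sum3.
  move=> o Po; have := guess_bound Po.
  by case: o Po => [[[[[[[[s1 s2] q] w1] w2] x1] x2] y1] y2] Po.
rewrite (eq_bigr (fun o => P o * ln (3 * #|Y1|%:R) + P o * nonzero o * ln a%:R
  + P o * collision o)); last by move=> o _; rewrite /phi; ring.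
rewrite !big_split /= -!mulr_suml sum_LC_joint1 mul1r.
rewrite lerD ?collision_le1 // lerD2l mulrC.
have -> : \sum_o P o * nonzero o = k%:R^-1.
  rewrite -(src_snd_nonzero R eta a2 k2).
  rewrite (sum_LC_joint_src (fun _ s2 => (s2 != w0)%:R)).
  by apply: eq_bigr => o _; rewrite (is_zero_wordE a2).
by [].
Qed.

Lemma law_source1 (s : word) : s != w0 ->
  law P (fun o : outcome => let '(s1, _, _, _, _, _, _, _, _) := o in s1) s
  = agree_mass R a k eta.
Proof.
move=> s0; rewrite lawE.
have := sum_LC_joint_src (fun s1 _ => (s1 == s)%:R).
have -> : \sum_o src_fam R eta o.1 o.2 * (o.1 == s)%:R = agree_mass R a k eta.
  rewrite (sum_src eta a2) /= [word0 k a2 == s]eq_sym (negPf s0) mulr0 add0r.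
  rewrite [X in _ + differ_mass _ _ _ _ * X]big1 // mulr0 addr0.
  rewrite (bigD1 s) //= eqxx [X in _ * (_ + X)]big1 ?addr0 ?mulr1 //.
  by move=> c /andP[_ /negPf ->].
by move=> <-; apply: eq_bigr; do 8 case.
Qed.

(** Only nonzero words are kept: they have total mass [(1 - 1/A) / k], and each has mass at most
    [a ^ - k]. *)
Lemma ent_source1_ge : (0 < eta)%N ->
  (1 - 1 / (a%:R : R) ^+ (eta * k)) * ln a%:R <=
  ent P (fun o : outcome => let '(s1, _, _, _, _, _, _, _, _) := o in s1).
Proof.
move=> eta0; rewrite /ent -sumrN (bigD1 w0) //=.
have a1 : 1 < a%:R :> R by rewrite ltr1n.
have a0 : 0 < a%:R :> R by rewrite (lt_trans ltr01).
have k0 : 0 < k%:R :> R by rewrite ltr0n ltnW.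
have n0 := nonzero_words_gt0 R a2 k2.
have A1 : 1 < (a%:R : R) ^+ (eta * k) by rewrite exprn_egt1 // -lt0n muln_gt0 eta0 ltnW.
set law1 := law P _.
have law_le1 : law1 w0 <= 1.
  rewrite -[leRHS]sum_LC_joint1 /law1 lawE; apply: ler_sum => o _.
  rewrite -[leRHS]mulr1; apply: ler_wpM2l; first exact: LC_joint_ge0.
  by rewrite lern1 leq_b1.
have law_ge0 : 0 <= law1 w0 by apply: sumr_ge0 => o _; apply: LC_joint_ge0.
have first0 : 0 <= - plogp (law1 w0).
  rewrite /plogp oppr_ge0; case: eqP => // _.
  by rewrite mulr_ge0_le0 // ln_le0.
rewrite (eq_bigr (fun=> - plogp (agree_mass R a k eta))); last first.
  by move=> s s0; rewrite /law1 law_source1.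
rewrite card_nonzero_words //.
set m := agree_mass R a k eta.
have m0 : 0 < m.
  rewrite divr_gt0 ?subr_gt0 // mulr_gt0 // mulr_gt0 //.
  exact: lt_trans A1.
have mn : m * ((a%:R : R) ^+ k - 1) = (1 - 1 / (a%:R : R) ^+ (eta * k)) / k%:R.
  exact: agree_mass_total.
have B0 : 0 <= 1 - 1 / (a%:R : R) ^+ (eta * k).
  rewrite subr_ge0 ler_pdivrMr ?(lt_trans ltr01) // mul1r; exact: ltW.
(* Reduces to [a ^ k <= k (a ^ k - 1)], true since [k] and [a ^ k] are at least 2. *)
have ln_m : k%:R * ln a%:R <= - ln m.
  rewrite -lnV ?posrE // mulr_natl -lnXn // ler_ln ?posrE ?invr_gt0 ?exprn_gt0 //.
  rewrite -[leLHS]invrK lef_pV2 ?posrE ?invr_gt0 ?exprn_gt0 //.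
  rewrite -[m](mulfK (lt0r_neq0 n0)) mn ler_pdivrMr // ler_pdivrMr //.
  apply: (@le_trans _ _ 1); first by rewrite lerBlDr lerDl divr_ge0 // ltW // (lt_trans ltr01).
  rewrite -mulrA mulrC ler_pdivlMr ?exprn_gt0 // mul1r.
  have ak : 2 <= (a%:R : R) ^+ k.
    apply: (@le_trans _ _ a%:R); first by rewrite ler_nat.
    by rewrite -{1}[a%:R]expr1 ler_weXn2l // ?(ltW a1) // ltnW.
  have kk : 2 <= k%:R :> R by rewrite ler_nat.
  have := ler_wpM2l (ltW n0) kk; lra.
have -> : (1 - 1 / (a%:R : R) ^+ (eta * k)) * ln a%:R
   = (1 - 1 / (a%:R : R) ^+ (eta * k)) / k%:R * (k%:R * ln a%:R).
  by rewrite mulrA divfK // gt_eqF.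
have -> : plogp m = m * ln m by rewrite /plogp gt_eqF.
rewrite -mn.
apply: (@le_trans _ _ (m * ((a%:R : R) ^+ k - 1) * - ln m)).
  by apply: ler_wpM2l => //; rewrite mulr_ge0 // ltW.
have -> : m * ((a%:R : R) ^+ k - 1) * - ln m = ((a%:R : R) ^+ k - 1) * - (m * ln m) by ring.
by rewrite lerDr.
Qed.

End LiuChenFails.

(** With [L = ln a], the condition would give [3/4 L < 7 L / (2 k) + 4], where 4 covers [ln 3 < 3]
    and the collisions. For [k >= 14] the fraction is at most [L / 4], and [L >= 8] is a
    contradiction. *)
Lemma not_LiuChen (R : realType) (a k eta : nat) (X1 Y1 X2 Y2 : finType)
    (Ws1 : X1 -> Y1 -> R) (Ws2 : X2 -> Y2 -> R) :
  (0 < eta)%N -> (2 <= a)%N -> (14 <= k)%N -> expR 8 <= a%:R :> R ->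
  is_channel Ws1 -> is_channel Ws2 -> #|Y1|%:R <= powR (a%:R : R) (5 / (2 * k%:R)) ->
  ~ LiuChen (@src_fam R a k eta) (ic_fam a Ws1 Ws2).
Proof.
move=> eta0 a2 k14 a8 W1ch W2ch Y1le.
have k2 : (2 <= k)%N by apply: leq_trans k14.
have kR : 14 <= k%:R :> R by rewrite ler_nat.
have k0 : 0 < k%:R :> R by lra.
have aR : 2 <= a%:R :> R by rewrite ler_nat.
have a0 : 0 < a%:R :> R by lra.
move=> [Q [W1 [W2 [pQ [pW1 [pW2 [pX1 [pX2 [pQp [pW1p [pW2p [pX1p [pX2p [lt1 _]]]]]]]]]]]]]].
have low := ent_source1_ge a2 k2 W1ch W2ch pQp pW1p pW2p pX1p pX2p eta0.
have upp := cmi_receiver1_le eta a2 k2 W1ch W2ch pQp pW1p pW2p pX1p pX2p.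
have lt_all : (1 - 1 / (a%:R : R) ^+ (eta * k)) * ln a%:R
    < ln (3 * #|Y1|%:R) + ln a%:R / k%:R + 1.
  apply: le_lt_trans low _; apply: lt_le_trans upp.
  exact: lt1.
pose La : R := ln a%:R.
have La8 : 8 <= La by rewrite -[8](@expRK R) ler_ln ?posrE ?expR_gt0.
have A4 : 1 / (a%:R : R) ^+ (eta * k) <= 1 / 4.
  have A16 : 4 <= (a%:R : R) ^+ (eta * k).
    apply: (@le_trans _ _ (2 ^+ 2)); first by rewrite -natrX ler_nat.
    apply: (@le_trans _ _ (a%:R ^+ 2)); first by rewrite lerXn2r // nnegrE; lra.
    apply: ler_weXn2l; first by lra.
    by apply: leq_trans k2 _; rewrite leq_pmull.
  rewrite !div1r lef_pV2 ?posrE //; lra.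
have lnY : ln (3 * #|Y1|%:R) <= 3 + 5 / (2 * k%:R) * La.
  (* By convention [ln 0 = 0], so an empty alphabet obeys the bound too. *)
  have [->|Yn0] := posnP #|Y1|.
    rewrite mulr0 ln0 // addr_ge0 // mulr_ge0 ?divr_ge0 ?mulr_ge0 //; lra.
  have Y0 : 0 < #|Y1|%:R :> R by rewrite ltr0n.
  rewrite lnM ?posrE //; apply: lerD; first by apply/ltW/ln_sublinear.
  by rewrite /La -ln_powR ler_ln ?posrE // powR_gt0.
have ik : k%:R^-1 <= 14^-1 :> R by rewrite lef_pV2 ?posrE.
have ik0 : 0 < k%:R^-1 :> R by rewrite invr_gt0.
have e1 : La / k%:R <= La / 14 by apply: ler_wpM2l => //; lra.
have e2 : 5 / (2 * k%:R) * La = 5 / 2 * (La / k%:R).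
  by field; exact: lt0r_neq0.
have e3 : 3 / 4 * La <= (1 - 1 / (a%:R : R) ^+ (eta * k)) * La.
  by apply: ler_wpM2r; lra.
move: lt_all; rewrite -/La; lra.
Qed.

Theorem theorem6 (R : realType) (eta : nat) :
  (6 <= eta)%N -> ~~ odd eta ->
  exists astar kstar : nat, forall a k : nat,
    (2 <= a)%N -> (2 <= k)%N -> (astar <= a)%N -> (kstar <= k)%N ->
    forall (X1 Y1 X2 Y2 : finType) (Ws1 : X1 -> Y1 -> R) (Ws2 : X2 -> Y2 -> R),
      is_channel Ws1 -> is_channel Ws2 ->
      is_capacity Ws1 (C_I R a k) ->
      is_capacity Ws2 (C_I R a k +
                       hb (2 / (k%:R * (a%:R : R) ^+ (eta * k)))) ->
      (#|Y1|%:R <= powR (a%:R : R) (5 / (2 * k%:R))) ->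
      (#|Y2|%:R <= powR (a%:R : R) (5 / (2 * k%:R))) ->
      ~ LiuChen (@src_fam R a k eta) (ic_fam a Ws1 Ws2) /\
      transmissible (@src_fam R a k eta) (ic_fam a Ws1 Ws2).
Proof.
(* Both thresholds are those of [not_LiuChen]. *)
move=> eta6 _; exists (Num.bound (expR (8 : R))), 14 => a k a2 k2 astar kstar.
move=> X1 Y1 X2 Y2 Ws1 Ws2 W1ch W2ch cap1 cap2 Y1le _; split.
  apply: not_LiuChen => //; first exact: leq_trans eta6.
  apply: ltW; apply: lt_le_trans (archi_boundP (expR_ge0 _)) _.
  by rewrite ler_nat.
by apply: transmissible_ic => //; apply: leq_trans kstar.
Qed.
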